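(* Let $(X,\mathbb{R})$ be a topological flow with the small flow boundary property (SFBP). Then for any $\tau\in\mathbb{R}$ the following are equivalent: (1) $(X,\tau)$ is aperiodic; (2) $(X,\tau)$ has the small boundary property (SBP).
   Context: A topological flow $(X,\mathbb{R})$ is a compact metrizable space $X$ with a continuous action $(t,x)\mapsto tx$ of $\mathbb{R}$. It is fixed-point free if no $x\in X$ satisfies $tx=x$ for all $t\in\mathbb{R}$. For $\tau\in\mathbb{R}$, $(X,\tau)$ denotes the $\mathbb{Z}$-system generated by the homeomorphism $x\mapsto\tau x$. A topological dynamical system (t.d.s.) $(X,T)$ is a compact metrizable space with a homeomorphism $T$; it is aperiodic if there are no $x\in X$ and $n\geq1$ with $T^nx=x$. SBP: for a t.d.s. $(X,T)$ and $C\subset X$ put $\mathrm{ocap}(C)=\lim_{n\to\infty}\frac1n\max_{x\in X}\sum_{i=0}^{n-1}1_C(T^ix)$. $(X,T)$ has SBP if for each $x\in X$ and each neighborhood $U$ of $x$ there is a neighborhood $V\subset U$ of $x$ with $\mathrm{ocap}(\partial V)=0$. SFBP: for $A\subset X$ and $s<s'$ write $[s,s']A=\{ta:t\in[s,s'],a\in A\}$. A cross-section with injectivity time $\eta>0$ is a set $S\subset X$ such that $[-\eta,\eta]\times S\to X$, $(t,x)\mapsto tx$, is injective. For a subset $U$ of a closed cross-section with injectivity time $\eta$, the flow interior is $\mathrm{Int}^{\mathbb{R}}U:=\mathrm{Int}([-\eta,\eta]U)\cap U$ (interior in $X$) and the flow boundary is $\partial^{\mathbb{R}}U:=\overline U\setminus\mathrm{Int}^{\mathbb{R}}U$.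 A set is null if it has measure zero for every $\mathbb{R}$-invariant Borel probability measure on $X$. A closed cross-section $S$ with injectivity time $\eta$ has a small flow boundary if $[-\eta,\eta](\partial^{\mathbb{R}}S)$ is null. The flow $(X,\mathbb{R})$ has SFBP if it is fixed-point free and for each $x\in X$ and each closed cross-section $S'$ with $x\in\mathrm{Int}^{\mathbb{R}}(S')$ there is a closed subset $S\subset S'$ such that $x\in\mathrm{Int}^{\mathbb{R}}(S)$ and $S$ has a small flow boundary. *)

(* Defs.v *)
From HB Require Import structures.
From mathcomp Require Import all_boot all_order all_algebra.
From mathcomp Require Import all_classical all_reals all_analysis.
From mathcomp Require Import lra.

Set Implicit Arguments.
Unset Strict Implicit.
Unset Printing Implicit Defensive.
Import Order.TTheory GRing.Theory Num.Theory.
Import numFieldNormedType.Exports.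

Local Open Scope classical_set_scope.
Local Open Scope ring_scope.

Definition boundary (X : topologicalType) (V : set X) : set X :=
  closure V `\` interior V.

Definition aperiodic (X : Type) (T : X -> X) : Prop :=
  ~ exists x n, (0 < n)%N /\ iter n T x = x.

Section OrbitCapacity.
Variables (R : realType) (X : Type).
Implicit Types (T : X -> X) (C : set X).

Definition visits T C (n : nat) (x : X) : R :=
  \sum_(0 <= i < n) \1_C (iter i T x).

(* For nonempty [X] this supremum is a maximum: see [max_visits_attained]. *)
Definition max_visits T C (n : nat) : R := sup (range (visits T C n)).

(* This limit always exists: see [is_cvg_ocap]. *)
Definition ocap T C : R := limn (fun n => n%:R^-1 * max_visits T C n).

Lemma visitsE T C n x :
  visits T C n x = (\sum_(0 <= i < n) (iter i T x \in C : nat))%N%:R.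
Proof. by rewrite natr_sum; apply: eq_bigr => i _; rewrite indicE. Qed.

Lemma visits_ge0 T C n x : 0 <= visits T C n x.
Proof. by rewrite visitsE. Qed.

Lemma visits_le T C n x : visits T C n x <= n%:R.
Proof.
rewrite visitsE ler_nat -[leqRHS]subn0 -[leqRHS]muln1 -sum_nat_const_nat.
by apply: leq_sum => i _; case: (_ \in _).
Qed.

Lemma visitsD T C m n x :
  visits T C (m + n) x = visits T C m x + visits T C n (iter m T x).
Proof.
rewrite /visits (big_cat_nat (leq0n m) (leq_addr n m)) /=; congr (_ + _).
rewrite -{1}[m]add0n big_addn addKn.
by apply: eq_bigr => i _; rewrite iterD.
Qed.

Lemma visits_le_max T C n x : visits T C n x <= max_visits T C n.
Proof.
apply: ub_le_sup; last by exists x.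
by exists n%:R => _ [y _ <-]; exact: visits_le.
Qed.

Lemma max_visits_le T C n (b : R) : 0 <= b ->
  (forall x, visits T C n x <= b) -> max_visits T C n <= b.
Proof.
move=> b0 vb; have [v0|/set0P ne] := eqVneq (range (visits T C n)) set0.
  by rewrite /max_visits v0 sup0.
by apply: ge_sup => // _ [x _ <-].
Qed.

Lemma max_visits_ge0 T C n : 0 <= max_visits T C n.
Proof.
have [v0|/set0P[_ [x _ _]]] := eqVneq (range (visits T C n)) set0.
  by rewrite /max_visits v0 sup0.
exact: le_trans (visits_ge0 T C n x) (visits_le_max T C n x).
Qed.

Lemma max_visits_attained T C n (x0 : X) :
  exists x, max_visits T C n = visits T C n x.
Proof.
pose c x := (\sum_(0 <= i < n) (iter i T x \in C : nat))%N.
pose P k := `[< exists x, c x = k >].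
have exP : exists k, P k by exists (c x0); apply/asboolP; exists x0.
have Pn k : P k -> (k <= n)%N.
  by move=> /asboolP[x <-]; rewrite -(ler_nat R) -visitsE visits_le.
case: (ex_maxnP exP Pn) => k /asboolP[x xk] kmax; exists x; apply/eqP.
rewrite eq_le visits_le_max andbT; apply: max_visits_le => [|y].
  exact: visits_ge0.
by rewrite !visitsE ler_nat -/(c x) xk; apply: kmax; apply/asboolP; exists y.
Qed.

Lemma max_visitsD T C m n :
  max_visits T C (m + n) <= max_visits T C m + max_visits T C n.
Proof.
apply: max_visits_le => [|x]; first by rewrite addr_ge0 ?max_visits_ge0.
by rewrite visitsD lerD ?visits_le_max.
Qed.

Lemma max_visitsMD T C m q r :
  max_visits T C (q * m + r) <= q%:R * max_visits T C m + r%:R.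
Proof.
elim: q => [|q IH].
  rewrite mul0n mul0r !add0r add0n; apply: max_visits_le => // x.
  exact: visits_le.
rewrite mulSn -addnA (le_trans (max_visitsD _ _ _ _))//.
by rewrite -natr1 mulrDl mul1r; lra.
Qed.

Lemma is_cvg_ocap T C : cvgn (fun n => n%:R^-1 * max_visits T C n).
Proof.
pose u n := n%:R^-1 * max_visits T C n.
pose L := inf [set u n | n in [set n | (0 < n)%N]].
have u_ge0 n : 0 <= u n by rewrite mulr_ge0 ?invr_ge0 ?max_visits_ge0.
have hasL : has_inf [set u n | n in [set n | (0 < n)%N]].
  by split; [exists (u 1%N), 1%N|exists 0 => _ [n _ <-]; exact: u_ge0].
suff : u @ \oo --> L by move/cvgP.
apply/cvgrPdist_le => e e0.
have e20 : 0 < e / 2 by rewrite divr_gt0.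
have [_ [m /= m0 <-] um] := inf_adherent e20 hasL; rewrite -/L in um.
have [N Ne] : exists N : nat, m%:R / (e / 2) <= N%:R.
  by exists (Num.truncn (m%:R / (e / 2))).+1; rewrite ltW ?truncnS_gt.
near=> n.
have n0 : (0 < n)%N by near: n; exact: nbhs_infty_gt.
have nN : (N <= n)%N by near: n; exact: nbhs_infty_ge.
have n0R : 0 < n%:R :> R by rewrite ltr0n.
have m0R : 0 < m%:R :> R by rewrite ltr0n.
have Lun : L <= u n by apply: (ge_inf hasL.2); exists n.
rewrite distrC ger0_norm ?subr_ge0// lerBlDr.
have aq : max_visits T C n <= n%:R * u m + m%:R.
  rewrite {1}(divn_eq n m) (le_trans (max_visitsMD _ _ _ _ _))// lerD//.
    have -> : max_visits T C m = m%:R * u m by rewrite mulVKf ?gt_eqF.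
    by rewrite mulrA -natrM ler_wpM2r// ler_nat leq_divM.
  by rewrite ler_nat ltnW// ltn_pmod.
have : u n <= u m + m%:R / n%:R.
  rewrite {1}/u ler_pdivrMl// mulrDr [n%:R * (_ / _)]mulrCA.
  by rewrite divff ?gt_eqF// mulr1.
move=> /le_trans; apply.
have : m%:R / n%:R <= e / 2.
  rewrite ler_pdivrMr// mulrC -ler_pdivrMr//.
  by rewrite (le_trans Ne)// ler_nat.
move: um; set a := m%:R / _; set b := u m => h1 h2.
by lra.
Unshelve. all: by end_near.
Qed.

End OrbitCapacity.

Definition SBP (R : realType) (X : topologicalType) (T : X -> X) : Prop :=
  forall (x : X) (U : set X), nbhs x U ->
    exists V, [/\ nbhs x V, V `<=` U & ocap R T (boundary V) = 0].

Record flow (R : realType) (X : topologicalType) := Flow {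
  act :> R -> X -> X;
  act_continuous : continuous (fun p : R * X => act p.1 p.2);
  act0 : forall x, act 0 x = x;
  actD : forall s t x, act (s + t) x = act s (act t x)
}.

(* Measurable types of the library are pointed; the base point [x0] serves only
   to turn [X] into one and the Borel sets do not depend on it. *)
Definition pointed_at (X : choiceType) (x0 : X) : Type := X.

HB.instance Definition _ (X : choiceType) (x0 : X) :=
  Choice.on (pointed_at x0).
HB.instance Definition _ (X : choiceType) (x0 : X) :=
  isPointed.Build (pointed_at x0) x0.

Definition borel (X : topologicalType) (x0 : X) : measurableType _ :=
  g_sigma_algebraType (@open X : set (set (pointed_at x0))).

Section Flow.
Context {R : realType} {X : topologicalType}.
Variable phi : flow R X.

Definition fixed_point_free : Prop := ~ exists x, forall t, phi t x = x.

Definition flow_invariant (x0 : X) (mu : set (borel x0) -> \bar R) : Prop :=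
  forall (t : R) (A : set (borel x0)),
    measurable A -> mu (phi t @^-1` A) = mu A.

Definition null (A : set X) : Prop :=
  forall (x0 : X) (mu : probability (borel x0) R),
    flow_invariant mu -> mu.-negligible (A : set (borel x0)).

Definition flow_seg (s s' : R) (A : set X) : set X :=
  [set phi t a | t in `[s, s'] & a in A].

Definition cross_section (eta : R) (S : set X) : Prop :=
  0 < eta /\
  set_inj (`[- eta, eta] `*` S) (fun p : R * X => phi p.1 p.2).

Definition flow_int (eta : R) (U : set X) : set X :=
  interior (flow_seg (- eta) eta U) `&` U.

Definition flow_bd (eta : R) (U : set X) : set X :=
  closure U `\` flow_int eta U.

Definition small_flow_boundary (eta : R) (S : set X) : Prop :=
  null (flow_seg (- eta) eta (flow_bd eta S)).

(* A subset of a cross-section with injectivity time [eta] is again one with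
   injectivity time [eta]. The flow interior of a subset of a closed
   cross-section, and the nullity of [-eta, eta] acting on its flow boundary,
   do not depend on which injectivity time is used. *)
Definition SFBP : Prop :=
  fixed_point_free /\
  forall (x : X) (eta : R) (S' : set X),
    closed S' -> cross_section eta S' -> flow_int eta S' x ->
    exists S : set X, [/\ closed S, S `<=` S', flow_int eta S x &
      small_flow_boundary eta S].

End Flow.

(* Main.v *)
(* If an iterate of T = phi tau fixes x, the orbit of x under the flow is a
   connected set of T-periodic points, and the boundary of a small neighbourhood
   of x meets it: this boundary has positive orbit capacity.

   Conversely, let S be a closed cross-section with small flow boundary near x.
   The box {phi t s | s in S, g1 s <= t <= g2 s} has boundary contained in the
   part over the flow boundary of S and the graphs {phi (g s) s | s in S} of
   g = g1, g2. The first part has zero orbit capacity by Krylov-Bogoliubov: an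
   orbit of T visiting it with positive frequency would yield a flow-invariant
   probability charging its thickening along the flow. For the graphs, g has to
   be chosen generically (for a constant g the graph may be T-invariant). It is
   enough that the returns of the graph to itself under each iterate of T be
   rare. As T is aperiodic such returns join different points of S, and it
   suffices to treat those from A to B with A, B disjoint closed sets. Add to g
   a function u equal to e or -e on most of A and to 0 on B: the sign is chosen
   so that the defect of coincidence is pushed away from 0, and it changes only
   across the flow boundary of a set E given by the small boundary hypothesis,
   near which orbits spend little time. Countably many such perturbations, each
   small with respect to the previous ones, give g in the limit. *)

From HB Require Import structures.
Require Import Defs.
From mathcomp Require Import all_boot all_order all_algebra.
From mathcomp Require Import all_classical all_reals all_analysis.
From mathcomp Require Import lra.

Set Implicit Arguments.
Unset Strict Implicit.
Unset Printing Implicit Defensive.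
Import Order.TTheory GRing.Theory Num.Theory.
Import numFieldNormedType.Exports.

Local Open Scope classical_set_scope.
Local Open Scope ring_scope.

(** * Orbit capacity *)

Section OrbitCapacityTheory.
Context {R : realType} {X : Type}.
Implicit Types (T : X -> X) (A C : set X).

Lemma visitsS T C n x :
  visits R T C n.+1 x = \1_C x + visits R T C n (T x).
Proof.
rewrite -add1n visitsD; congr (_ + _).
by rewrite /visits big_nat1.
Qed.

Lemma le_visits T A C n x : A `<=` C -> visits R T A n x <= visits R T C n x.
Proof.
move=> AC; apply: ler_sum => i _; rewrite !indicE.
have [/set_mem/AC/mem_set -> //|_] := boolP (iter i T x \in A).
exact: ler0n.
Qed.

Lemma visits_leU T A C n x :
  visits R T (A `|` C) n x <= visits R T A n x + visits R T C n x.
Proof.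
rewrite -big_split; apply: ler_sum => i _; rewrite !indicE in_setU.
by case: (_ \in A); case: (_ \in C) => /=; lra.
Qed.

Lemma visits_mulD T C m n x :
  visits R T C (n * m) x = \sum_(i < n) visits R T C m (iter (i * m) T x).
Proof.
elim: n => [|n IH]; first by rewrite big_ord0 /visits big_nil.
by rewrite mulSnr visitsD IH big_ord_recr.
Qed.

Lemma ocap_cvg T C :
  n%:R^-1 * max_visits R T C n @[n --> \oo] --> ocap R T C.
Proof. exact: is_cvg_ocap. Qed.

Lemma ocap_ge0 T C : 0 <= ocap R T C.
Proof.
apply: limr_ge; first exact: is_cvg_ocap.
by apply: nearW => n; rewrite mulr_ge0 ?invr_ge0 ?max_visits_ge0.
Qed.

(** Fekete's argument: by subadditivity the ratio at any multiple of [n] is at most the ratio at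
    [n], and the limit can be read along these multiples. *)
Lemma ocap_le_ratio T C n : (0 < n)%N ->
  ocap R T C <= n%:R^-1 * max_visits R T C n.
Proof.
move=> n0; apply/ler_addgt0Pl => e e0.
have /cvgrPdist_lt/(_ _ e0)[N _ /(_ (N.+1 * n)%N)] := @ocap_cvg T C.
rewrite /= (leq_trans (leqnSn N)) ?leq_pmulr// => /(_ isT) h.
have : (N.+1 * n)%:R^-1 * max_visits R T C (N.+1 * n) <=
    n%:R^-1 * max_visits R T C n.
  have nR : 0 < n%:R :> R by rewrite ltr0n.
  rewrite ler_pdivrMl ?ltr0n ?muln_gt0// natrM -mulrA mulVKf ?gt_eqF//.
  by have := max_visitsMD R T C n N.+1 0; rewrite addn0 addr0.
move: h; rewrite ltr_norml => /andP[_]; set u := _ * max_visits _ _ _ _.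
by set v := _ * max_visits _ _ _ _ => h1 h2; lra.
Qed.

Lemma le_ocap T A C : A `<=` C -> ocap R T A <= ocap R T C.
Proof.
move=> AC; apply: ler_lim; [exact: is_cvg_ocap|exact: is_cvg_ocap|].
apply: nearW => n; rewrite ler_wpM2l ?invr_ge0//.
apply: max_visits_le => [|x]; first exact: max_visits_ge0.
exact: le_trans (le_visits _ _ _ AC) (visits_le_max _ _ _ _ _).
Qed.

Lemma ocap_eq0S T A C : A `<=` C -> ocap R T C = 0 -> ocap R T A = 0.
Proof.
by move=> AC C0; apply/eqP; rewrite eq_le ocap_ge0 andbT -C0 le_ocap.
Qed.

Lemma ocapU_eq0 T A C :
  ocap R T A = 0 -> ocap R T C = 0 -> ocap R T (A `|` C) = 0.
Proof.
move=> A0 C0; apply/eqP; rewrite eq_le ocap_ge0 andbT.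
have cvgAC : (fun n => n%:R^-1 * max_visits R T A n +
    n%:R^-1 * max_visits R T C n) @ \oo --> (0 : R).
  rewrite -[X in _ --> X](addr0 0) -{1}A0 -C0.
  by apply: cvgD; exact: ocap_cvg.
rewrite -(cvg_lim _ cvgAC)//.
apply: ler_lim; [exact: is_cvg_ocap|exact: cvgP cvgAC|].
apply: nearW => n /=; rewrite -mulrDr ler_wpM2l ?invr_ge0//.
apply: max_visits_le => [|x]; first by rewrite addr_ge0 ?max_visits_ge0.
by apply: le_trans (visits_leU _ _ _ _ _) _; rewrite lerD ?visits_le_max.
Qed.

Lemma ocap_set0 T : ocap R T set0 = 0.
Proof.
apply/eqP; rewrite eq_le ocap_ge0 andbT.
apply: le_trans (ocap_le_ratio T set0 (ltn0Sn 0)) _.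
rewrite invr1 mul1r; apply: max_visits_le => // x.
by rewrite /visits big_nat1 indicE in_set0.
Qed.

Lemma ocap_bigcup_seq_eq0 (I : choiceType) T (F : I -> set X) (s : seq I) :
  (forall i, i \in s -> ocap R T (F i) = 0) ->
  ocap R T (\bigcup_(i in [set` s]) F i) = 0.
Proof.
rewrite bigcup_seq; elim: s => [_|i s IH Fs];
  first by rewrite big_nil ocap_set0.
rewrite big_cons; apply: ocapU_eq0; first by rewrite Fs ?mem_head.
by apply: IH => j js; rewrite Fs// in_cons js orbT.
Qed.

(** A bound at one finite time, uniform in the starting point. It controls [ocap] and, unlike a
    limit, passes to small neighbourhoods of closed sets. *)
Definition rare (d : R) T C :=
  exists2 n, (0 < n)%N & forall x, visits R T C n x <= d * n%:R.

Lemma rare_ocap d T C : 0 <= d -> rare d T C -> ocap R T C <= d.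
Proof.
move=> d0 [n n0 nd]; apply: le_trans (ocap_le_ratio T C n0) _.
rewrite ler_pdivrMl ?ltr0n// mulrC.
by apply: max_visits_le => //; rewrite mulr_ge0.
Qed.

Lemma ocap_rare d T C : ocap R T C < d -> rare d T C.
Proof.
rewrite -subr_gt0 => d0.
have /cvgrPdist_lt/(_ _ d0)[N _ /(_ N.+1)] := @ocap_cvg T C.
rewrite /= leqnSn => /(_ isT); rewrite ltr_norml => /andP[h _].
exists N.+1 => // x; apply: le_trans (visits_le_max _ _ _ _ _) _.
rewrite mulrC -ler_pdivrMl ?ltr0n//; move: h; set u := _ * _ => h; lra.
Qed.

Lemma rareS d T A C : A `<=` C -> rare d T C -> rare d T A.
Proof.
move=> AC [n n0 nd]; exists n => // x.
by apply: le_trans (le_visits _ _ _ AC) _; exact: nd.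
Qed.

Lemma ocap_periodic T C n x : (0 < n)%N -> iter n T x = x -> C x ->
  0 < ocap R T C.
Proof.
move=> n0 Tx Cx; rewrite ltNge; apply/negP => C0.
have nR : 0 < n%:R :> R by rewrite ltr0n.
(* The orbit of [x] meets [C] with frequency at least 1 / n; half of this frequency already gives a
   contradiction. *)
have /ocap_rare[m m0 mC] : ocap R T C < (n%:R *+ 2)^-1.
  by rewrite (le_lt_trans C0)// invr_gt0 pmulrn_lgt0.
have vk k : k%:R <= visits R T C (k * n) x.
  elim: k => [|k IH]; first exact: visits_ge0.
  rewrite mulSn visitsD Tx -natr1 addrC lerD//.
  by rewrite -(prednK n0) visitsS indicE mem_set//= lerDl visits_ge0.
have := vk m; rewrite mulnC visits_mulD leNgt => /negP; apply.
have mR : 0 < m%:R :> R by rewrite ltr0n.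
apply: (@le_lt_trans _ _ (\sum_(i < n) (n%:R *+ 2)^-1 * m%:R)).
  by apply: ler_sum => i _; exact: mC.
rewrite sumr_const card_ord -[_ *+ n]mulr_natl mulrA -(mulr_natr n%:R 2).
rewrite invfM [_ / 2]mulrC [2^-1 * _]mulrC mulVKf ?gt_eqF//.
by rewrite gtr_pMl// invf_lt1 ?ltr1n.
Qed.
End OrbitCapacityTheory.

(** * Sets whose returns have zero orbit capacity *)

Section SparseReturns.
Context {R : realType} {X : Type}.
Variables (T : X -> X) (C : set X).

Let recur K := \bigcup_(k in [set` iota 1 K]) (C `&` iter k T @^-1` C).

(** Within at most K + 1 consecutive times, every visit to [C] except the last is followed by
    another one at most K steps later, so it is a visit to [recur K]. *)
Let visits_block K n y : (n <= K.+1)%N ->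
  visits R T C n y <= 1 + visits R T (recur K) n y.
Proof.
elim: n y => [|n IH] y nK; first by rewrite /visits !big_nil addr0.
have [vT0|vT] := eqVneq (visits R T C n (T y)) 0.
  rewrite visitsS vT0 addr0; apply: (@le_trans _ _ 1); last first.
    by rewrite lerDl visits_ge0.
  by rewrite indicE; case: (_ \in _).
have IHy := IH (T y) (ltnW nK).
rewrite !visitsS; suff : \1_C y <= \1_(recur K) y :> R by move: IHy; lra.
rewrite !indicE; have [Cy|_] := boolP (y \in C); last exact: ler0n.
suff -> : y \in recur K by [].
have [i [ni Ci]] : exists i, (i < n)%N /\ C (iter i T (T y)).
  apply: contrapT => /forallNP h; move/eqP: vT; apply.
  rewrite /visits big_nat big1// => i /andP[_ ni]; rewrite indicE.
  by have [/set_mem Ci|//] := boolP (_ \in C); case: (h i).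
apply/mem_set; exists i.+1.
  by rewrite /= mem_iota/= add1n ltnS (leq_trans ni)// -ltnS.
by split; [exact: set_mem|rewrite /= -iterS iterSr].
Qed.

Lemma sparse_returns_ocap_eq0 :
  (forall k, (0 < k)%N -> ocap R T (C `&` iter k T @^-1` C) = 0) ->
  ocap R T C = 0.
Proof.
move=> Ck0; apply/eqP; rewrite eq_le ocap_ge0 andbT.
apply/ler_addgt0Pl => e e0; rewrite addr0.
pose K := Num.truncn (2 / e).
have KR : 0 < K.+1%:R :> R by rewrite ltr0n.
have Ke : K.+1%:R^-1 <= e / 2.
  by rewrite -[e / 2]invf_div lef_pV2 ?posrE ?divr_gt0// ltW// truncnS_gt.
have recur0 : ocap R T (recur K) = 0.
  apply: ocap_bigcup_seq_eq0 => k; rewrite mem_iota => /andP[k1 _].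
  exact: Ck0.
have e20 : 0 < e / 2 by rewrite divr_gt0.
have [n n0 nD] : rare (e / 2) T (recur K) by apply: ocap_rare; rewrite recur0.
have nR : 0 < n%:R :> R by rewrite ltr0n.
apply: rare_ocap; first exact: ltW.
(* This length is cut in two ways: into [n] windows of length K + 1, each with at most one visit
   outside [recur K], and into K + 1 windows of length [n], where [recur K] is rare. *)
exists (n * K.+1)%N => [|y]; first by rewrite muln_gt0 n0.
apply: (@le_trans _ _ (n%:R + visits R T (recur K) (n * K.+1) y)).
  rewrite !visits_mulD -[X in X%:R]card_ord -sumr_const -big_split.
  by apply: ler_sum => i _; exact: visits_block.
rewrite mulnC visits_mulD.
apply: (@le_trans _ _ (n%:R + \sum_(i < K.+1) e / 2 * n%:R)).
  by rewrite lerD2l; apply: ler_sum => i _; exact: nD.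
rewrite sumr_const card_ord -[_ *+ _]mulr_natl natrM.
have : n%:R <= e / 2 * (K.+1%:R * n%:R).
  by rewrite mulrA ler_peMl// -ler_pdivrMr// div1r.
set a := K.+1%:R; set b := n%:R; lra.
Qed.

End SparseReturns.

(** * Flows *)

Section FlowTheory.
Context {R : realType} {X : metricType R}.
Variable phi : flow R X.

Lemma iter_act n t x : iter n (phi t) x = phi (n%:R * t) x.
Proof.
elim: n => [|n IH]; first by rewrite mul0r act0.
by rewrite iterS IH -actD -natr1 mulrDl mul1r addrC.
Qed.

Lemma act_near t x (W : set X) : nbhs (phi t x) W ->
  \forall s \near t & y \near x, W (phi s y).
Proof. exact: (@act_continuous _ _ phi (t, x)). Qed.

Lemma act_continuous_time x : continuous (phi ^~ x).
Proof.
move=> t W /act_near[[A B] /= [tA xB] AB]; apply: filterS tA => s As.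
by apply: (AB (s, x)); split => //; exact: nbhs_singleton.
Qed.

Lemma act_continuous_space t : continuous (phi t).
Proof.
move=> x W /act_near[[A B] /= [tA xB] AB]; apply: filterS xB => y By.
by apply: (AB (t, y)); split => //; exact: nbhs_singleton.
Qed.

Lemma actK t x : phi (- t) (phi t x) = x.
Proof. by rewrite -actD addNr act0. Qed.

Lemma actNK t x : phi t (phi (- t) x) = x.
Proof. by rewrite -actD subrr act0. Qed.

Lemma closed_metric_set1 (x : X) : closed [set x].
Proof.
by apply: accessible_closed_set1; apply: hausdorff_accessible;
  exact: metric_hausdorff.
Qed.

Lemma SBP_aperiodic tau :
  fixed_point_free phi -> SBP R (phi tau) -> aperiodic (phi tau).
Proof.
move=> ffree sbp [x [n [n0 Tx]]].
have [t tx] : exists t, phi t x <> x.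
  by apply: contrapT => /forallNP h; apply: ffree; exists x => t;
    apply: contrapT.
have /sbp[V [xV VU V0]] : nbhs x (~` [set phi t x]).
  apply: open_nbhs_nbhs; split; last exact/nesym.
  exact/closed_openC/closed_metric_set1.
have [s sV] : exists s, boundary V (phi s x).
  apply: contrapT => /forallNP h.
  (* If the orbit avoids the boundary of [V], the set of times spent in the interior is also the set
     of times spent in the closure. It is clopen and contains 0, hence also [t], against the choice
     of [V]. *)
  pose B := [set s | interior V (phi s x)].
  have BT : B = setT.
    have : connected [set: R] by apply/connected_intervalP.
    apply.
    - by exists 0; rewrite /B /= act0; exact: nbhs_singleton (nbhs_interior xV).
    - exists B; last by rewrite setTI.
      apply: open_comp; last exact: open_interior.
      by move=> s _; exact: act_continuous_time.
    - exists [set s | closure V (phi s x)].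
        apply: preimage_closed; last exact: closed_closure.
        by move=> s _; exact: act_continuous_time.
      rewrite setTI; apply/seteqP; split => s; rewrite /B /=.
        by move/interior_subset; exact: subset_closure.
      by move=> cVs; apply: contrapT => iVs; apply: (h s); split.
  have : B t by rewrite BT.
  by move/interior_subset/VU; apply.
have : iter n (phi tau) (phi s x) = phi s x.
  by rewrite iter_act -actD addrC actD -iter_act Tx.
by move=> /(ocap_periodic (R := R) n0)/(_ sV); rewrite V0 ltxx.
Qed.

End FlowTheory.

(** * From a finitely additive content to a Borel probability *)

Section CompactTheory.
Context {X : topologicalType}.

Lemma compact_finite_cover (K : set X) (f : X -> set X) : compact K ->
  (forall x, K x -> nbhs x (f x)) ->
  exists s : seq X, {in s, forall x, K x} /\
    forall y, K y -> exists2 x, x \in s & f x y.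
Proof.
move=> /compact_near_coveringP cK Kf.
(* Finite lists of points of [K] are directed by inclusion; the near-covering form of compactness
   along the resulting filter yields one list that serves all of [K]. *)
pose D : set (seq X) := [set s | {in s, forall x, K x}].
pose B (s0 : seq X) := [set s : seq X | D s /\ {subset s0 <= s}].
pose F := filter_from D B.
have FF : Filter F.
  apply: filter_from_filter; first by exists [::].
  move=> s1 s2 D1 D2; exists (s1 ++ s2).
    by move=> x; rewrite mem_cat => /orP[/D1|/D2].
  move=> s [Ds s12]; split; split => // x xs; apply: s12; rewrite mem_cat xs//.
  by rewrite orbT.
have cover x : K x -> \forall y \near x & s \near F, exists2 x, x \in s & f x y.
  move=> Kx; exists (f x, B [:: x]).
    split; first exact: Kf.
    by exists [:: x] => //= y; rewrite inE => /eqP ->.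
  by case=> y s /= [fy [_ xs]]; exists x => //; apply: xs; rewrite inE.
have [s Ds Bs] := cK _ F (fun s y => exists2 x, x \in s & f x y) FF cover.
by exists s; split => //; exact: (Bs s (conj Ds (fun x xs => xs))).
Qed.

Lemma compact_hausdorff_closed_nbhd (R : realType) (K U : set X) :
  hausdorff_space X -> compact [set: X] -> closed K -> open U -> K `<=` U ->
  exists W L, [/\ open W, closed L, K `<=` W, W `<=` L & L `<=` U].
Proof.
move=> hX cX cK oU KU; have /normal_openP := compact_normal hX cX.
move=> /(_ R K (~` U) cK (open_closedC oU)); case.
  by apply/disjoints_subset; rewrite setCK.
move=> W [V [oW oV KW UV WV0]]; exists W, (~` V); split => //.
- exact: open_closedC.
- by apply/disjoints_subset.
- by rewrite -[U]setCK; exact: subsetC.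
Qed.

End CompactTheory.

(** * A regular Borel probability from a content defined on all subsets *)

Section ContentMeasure.
Context {R : realType} {X : topologicalType}.
Hypotheses (hausX : hausdorff_space X) (cptX : compact [set: X]).
Variable lam : set X -> R.
Hypothesis lam0 : lam set0 = 0.
Hypothesis le_lam : {homo lam : A B / A `<=` B >-> A <= B}.
Hypothesis lamU : forall A B, lam (A `|` B) <= lam A + lam B.
Hypothesis lamDU : forall A B, A `&` B = set0 -> lam A + lam B <= lam (A `|` B).
Hypothesis lamT : lam setT = 1.

Let compactX (K : set X) : closed K -> compact K.
Proof. by move=> cK; apply: subclosed_compact cK cptX _. Qed.

Local Open Scope ereal_scope.

(** The first step of the Riesz-Markov construction: [lam] is only finitely additive, and on open
    sets it is replaced by its approximation from inside by closed sets. *)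
Definition inner (U : set X) : \bar R :=
  ereal_sup [set (lam K)%:E | K in [set K | closed K /\ K `<=` U]].

Lemma le_inner_closed K U : closed K -> K `<=` U -> (lam K)%:E <= inner U.
Proof. by move=> cK KU; apply: ereal_sup_ubound; exists K. Qed.

Lemma inner_le U (b : \bar R) :
  (forall K, closed K -> K `<=` U -> (lam K)%:E <= b) -> inner U <= b.
Proof. by move=> h; apply: ge_ereal_sup => _ [K [cK KU] <-]; exact: h. Qed.

Lemma inner_ge0 U : 0 <= inner U.
Proof.
apply: (@le_trans _ _ (lam set0)%:E); first by rewrite lam0.
by apply: le_inner_closed => //; exact: closed0.
Qed.

Lemma inner0 : inner set0 = 0.
Proof.
apply/eqP; rewrite eq_le inner_ge0 andbT; apply: inner_le => K _.
by rewrite subset0 => ->; rewrite lam0.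
Qed.

(** Normality cuts a closed subset [K] of the union into two closed pieces: one inside [L], a closed
    neighbourhood of [K] minus [V] within [U], and the rest [K] minus [W] inside [V]. *)
Lemma innerU U V : open U -> open V -> inner (U `|` V) <= inner U + inner V.
Proof.
move=> oU oV; apply: inner_le => K cK KUV.
have cKV : closed (K `\` V) by apply: closedI => //; exact: open_closedC.
have KVU : K `\` V `<=` U by move=> x [/KUV[]].
have [W [L [oW cL KW WL LU]]] :=
  compact_hausdorff_closed_nbhd R hausX cptX cKV oU KVU.
have KWV : K `\` W `<=` V.
  by move=> x [Kx Wx]; apply: contrapT => Vx; apply/Wx/KW; split.
have cKW : closed (K `\` W) by apply: closedI => //; exact: open_closedC.
apply: (@le_trans _ _ (lam L + lam (K `\` W))%:E); last first.
  by rewrite EFinD leeD// le_inner_closed.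
rewrite lee_fin; apply: le_trans (lamU _ _); apply: le_lam => x Kx.
by have [/WL|] := pselect (W x); [left|right].
Qed.

Lemma inner_bigsetU (U : nat -> set X) n : (forall i, open (U i)) ->
  inner (\big[setU/set0]_(i < n) U i) <= \sum_(i < n) inner (U i).
Proof.
move=> oU; elim: n => [|n IH]; first by rewrite !big_ord0 inner0.
rewrite !big_ord_recr /=; apply: le_trans (innerU _ _) _ => //.
  by rewrite -bigcup_mkord; exact: bigcup_open.
exact: leeD.
Qed.

Lemma inner_bigcup (U : nat -> set X) (V : set X) : (forall i, open (U i)) ->
  V `<=` \bigcup_i U i -> inner V <= \sum_(i <oo) inner (U i).
Proof.
move=> oU VU; apply: inner_le => K cK KV.
have [n _ /(_ n (leqnn n)) Kn] : \forall n \near \oo,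
    K `<=` \big[setU/set0]_(i < n) U i.
  have /compact_near_coveringP := compactX cK; apply => x /KV/VU[i _ Uix].
  exists (U i, [set n | (i < n)%N]) => /=.
    by split; [exact: open_nbhs_nbhs|exists i.+1].
  by move=> [y n] /= [Uy ni]; rewrite -bigcup_mkord; exists i.
apply: le_trans (le_inner_closed cK Kn) _.
apply: le_trans (inner_bigsetU _ oU) _.
rewrite -(big_mkord xpredT (inner \o U)).
by apply: nneseries_lim_ge => i _ _; exact: inner_ge0.
Qed.

Variable x0 : X.

(* The value +oo off the open sets restricts mu_ext to covers by open sets. *)
Definition open_content (U : set (borel x0)) : \bar R :=
  if `[< @open X U >] then inner U else +oo.

Lemma open_contentE U : open U -> open_content U = inner U.
Proof. by move=> oU; rewrite /open_content asboolT. Qed.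

Lemma open_content_ge0 U : 0 <= open_content U.
Proof. by rewrite /open_content; case: ifPn => // _; exact: inner_ge0. Qed.

Lemma open_content0 : open_content set0 = 0.
Proof. by rewrite open_contentE ?inner0//; exact: open0. Qed.

Definition content_measure : set (borel x0) -> \bar R := mu_ext open_content.

Lemma open_measurable_borel (U : set X) : open U ->
  measurable (U : set (borel x0)).
Proof. by move=> oU; exact: sub_sigma_algebra. Qed.

Lemma content_measure_le (A : set X) (U : nat ->
  set X) : (forall i, open (U i)) ->
  A `<=` \bigcup_i U i -> content_measure A <= \sum_(i <oo) inner (U i).
Proof.
move=> oU AU; apply: ereal_inf_lbound; exists U.
  by split => // i; exact: open_measurable_borel.
by apply: eq_eseriesr => i _; rewrite open_contentE.
Qed.

Lemma content_measure_ge (A : set X) (b : \bar R) :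
  (forall U : nat -> set X, (forall i, open (U i)) -> A `<=` \bigcup_i U i ->
    b <= \sum_(i <oo) inner (U i)) -> b <= content_measure A.
Proof.
move=> h; apply: le_ereal_inf_tmp => _ [U [mU AU] <-].
have [oU|] := pselect (forall i, @open X (U i)).
  rewrite (eq_eseriesr (g := inner \o U))//; first exact: h.
  by move=> i _; rewrite open_contentE.
move=> /existsNP[i nUi]; rewrite (@eseries_pinfty _ _ _ i) ?leey//.
  by move=> n _; rewrite -ltNye (lt_le_trans _ (open_content_ge0 _)).
by rewrite /open_content asboolF.
Qed.

HB.instance Definition _ := isOuterMeasure.Build R (borel x0) content_measure
  (mu_ext0 open_content0 open_content_ge0) (mu_ext_ge0 open_content_ge0)
  (@le_mu_ext _ _ _ open_content) (mu_ext_sigma_subadditive open_content_ge0).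

Lemma content_measure_open (U : set X) : open U -> content_measure U = inner U.
Proof.
move=> oU; apply/eqP; rewrite eq_le; apply/andP; split; last first.
  by apply: content_measure_ge => V oV UV; exact: inner_bigcup.
apply: le_trans (@content_measure_le _ (fun i => if i is 0%N then U else set0)
  _ _) _.
- by case=> // _; exact: open0.
- by move=> x Ux; exists 0%N.
rewrite (nneseries_split _ 1); last by move=> k _; exact: inner_ge0.
by rewrite big_nat1 eseries0 ?adde0// => -[]// n _ _; exact: inner0.
Qed.

Lemma closed_le_content_measure (K : set X) : closed K ->
  (lam K)%:E <= content_measure K.
Proof.
move=> cK; apply: content_measure_ge => U oU KU.
apply: le_trans (inner_bigcup oU KU).
exact: le_inner_closed.
Qed.

(** Countable open covers reduce the test set to an open [W]. Exhaust [W] meet [U] by closed sets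
    [K], then [W] minus [K] by closed sets [L]: as [K] and [L] are disjoint, [lamDU] bounds the sum
    by the content of [W]. *)
Lemma open_caratheodory (U : set X) : open U ->
  content_measure.-caratheodory (U : set (borel x0)).
Proof.
move=> oU; apply: le_caratheodory_measurable => /= A.
have openW W : open W ->
    content_measure (W `&` U) + content_measure (W `&` ~` U) <= inner W.
  move=> oW; rewrite content_measure_open; last exact: openI.
  have fin : content_measure (W `&` ~` U) \is a fin_num.
    rewrite ge0_fin_numE; last exact: mu_ext_ge0 open_content_ge0 _.
    apply: (@le_lt_trans _ _ (content_measure setT)); first exact: le_mu_ext.
    rewrite content_measure_open; last exact: openT.
    apply: (@le_lt_trans _ _ 1); last exact: ltry.
    by apply: inner_le => K _ _; rewrite -lamT lee_fin le_lam.
  rewrite -leeBrDr//; apply: inner_le => K cK KWU.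
  rewrite leeBrDr// addeC -leeBrDr//.
  apply: (@le_trans _ _ (content_measure (W `\` K))).
    by apply: le_mu_ext => x [Wx Ux]; split => // /KWU[].
  have oWK : open (W `\` K) by apply: openI => //; exact: closed_openC.
  rewrite content_measure_open//; apply: inner_le => L cL LWK.
  rewrite leeBrDr// -EFinD; apply: (@le_trans _ _ (lam (L `|` K))%:E).
    rewrite lee_fin; apply: lamDU; apply/disjoints_subset => x /LWK[_].
    exact.
  apply: le_inner_closed; first exact: closedU.
  by move=> x [/LWK[]|/KWU[]].
apply: content_measure_ge => W oW AW.
apply: (@le_trans _ _ (\sum_(i <oo)
    (content_measure (W i `&` U) + content_measure (W i `&` ~` U))));
      last first.
  apply: lee_nneseries => i _; last exact: openW.
  by move=> _; rewrite adde_ge0// mu_ext_ge0//; exact: open_content_ge0.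
rewrite nneseriesD; [|by move=> *; exact: mu_ext_ge0 open_content_ge0 _..].
apply: leeD.
  apply: le_trans (outer_measure_sigma_subadditive content_measure _).
  by apply: le_mu_ext; rewrite -setI_bigcupl; exact: setSI.
apply: le_trans (outer_measure_sigma_subadditive content_measure _).
by apply: le_mu_ext; rewrite -setI_bigcupl; exact: setSI.
Qed.

Lemma borel_caratheodory (A : set (borel x0)) : measurable A ->
  content_measure.-caratheodory A.
Proof.
apply: smallest_sub => [|U]; last exact: open_caratheodory.
split => [|B mB|F mF]; first exact: caratheodory_measurable_set0.
- by rewrite setTD; exact: caratheodory_measurable_setC.
- exact: caratheodory_measurable_bigcup.
Qed.

Lemma content_measure_semi_sigma_additive : semi_sigma_additive content_measure.
Proof.
move=> F mF tF mUF; apply: caratheodory_measure_sigma_additive => //.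
  by move=> i; exact: borel_caratheodory.
exact: borel_caratheodory.
Qed.

HB.instance Definition _ := isMeasure.Build _ _ _ content_measure
  (mu_ext0 open_content0 open_content_ge0) (mu_ext_ge0 open_content_ge0)
  content_measure_semi_sigma_additive.

Lemma content_measure_setT : content_measure setT = 1.
Proof.
rewrite content_measure_open; last exact: openT.
apply/eqP; rewrite eq_le; apply/andP; split.
  by apply: inner_le => K _ _; rewrite -lamT lee_fin le_lam.
by rewrite -lamT; apply: le_inner_closed => //; exact: closedT.
Qed.

HB.instance Definition _ := Measure_isProbability.Build _ _ _ content_measure
  content_measure_setT.

(** Pulling open covers back along [f] extends the inequality from open sets to all sets. Applied to
    a homeomorphism and to its inverse it gives invariance. *)
Lemma content_measure_preimage (f : X -> X) : continuous f ->
  (forall U, open U -> inner (f @^-1` U) <= inner U) ->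
  forall A : set X, content_measure (f @^-1` A) <= content_measure A.
Proof.
move=> cf fU A; apply: content_measure_ge => U oU AU.
apply: le_trans (@content_measure_le _ (fun i => f @^-1` U i) _ _) _.
- by move=> i; apply: open_comp => // x _; exact: cf.
- by rewrite -preimage_bigcup; exact: preimage_subset.
- by apply: lee_nneseries => [i _ _|i _]; [exact: inner_ge0|exact: fU].
Qed.

Lemma exists_content_probability : exists mu : probability (borel x0) R,
  (forall K : set X, closed K -> (lam K)%:E <= mu K) /\
  forall f : X -> X, continuous f ->
    (forall U, open U -> inner (f @^-1` U) <= inner U) ->
    forall A : set X, mu (f @^-1` A) <= mu A.
Proof.
exists content_measure; split; first exact: closed_le_content_measure.
exact: content_measure_preimage.
Qed.

End ContentMeasure.

(** * Krylov-Bogoliubov *)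

(** The two counts range over time windows shifted by [j], which differ by at most [j] times at each
    end. *)
Lemma visits_iter_shift (R : realType) (Y : Type) (T : Y ->
  Y) (A : set Y) j n y :
  `|visits R T (iter j T @^-1` A) n y - visits R T A n y| <= j%:R.
Proof.
have -> : visits R T (iter j T @^-1` A) n y = visits R T A n (iter j T y).
  apply: eq_bigr => i _; rewrite !indicE; congr (_%:R).
  by apply/congr1/asbool_equiv_eq; rewrite /= -!iterD addnC.
have := visitsD R T A j n y; rewrite addnC visitsD => h.
have := visits_ge0 R T A j y; have := visits_le R T A j y.
have := visits_ge0 R T A j (iter n T y); have := visits_le R T A j (iter n T y).
move=> h1 h2 h3 h4; rewrite ler_norml; move: h; lra.
Qed.

Lemma visits_full (R : realType) (Y : Type) (T : Y -> Y) (A : set Y) n y :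
  (forall i, (i < n)%N -> A (iter i T y)) -> visits R T A n y = n%:R.
Proof.
move=> Ai; rewrite visitsE big_nat (eq_bigr (fun=> 1%N)).
  by rewrite -big_nat sum_nat_const_nat muln1 subn0.
by move=> i /andP[_ /Ai Aii]; rewrite mem_set.
Qed.

(** The image of [F] is an ultrafilter on a compact segment. *)
Lemma ultra_bounded_cvg (R : realType) (I : Type) (F : set_system I) (u : I ->
  R)
  (a b : R) : UltraFilter F -> (forall i, a <= u i <= b) -> cvg (u @ F).
Proof.
move=> UF ab; have UuF : UltraFilter (u @ F).
  split; first exact: fmap_proper_filter.
  move=> G PG FG; apply/seteqP; split => // A GA.
  have [//|] := in_ultra_setVsetC (u @^-1` A) UF.
  by move=> /(FG (~` A)) /(filterI GA); rewrite setICr => /filter_not_empty.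
have := @segment_compact R a b; rewrite compact_ultra => /(_ _ UuF).
case; first by apply: (@filterE _ F) => i /=; rewrite in_itv/= ab.
by move=> l [_ ul]; apply/cvg_ex; exists l.
Qed.

Section KrylovBogoliubov.
Context {R : realType} {X : metricType R}.
Hypothesis cptX : compact [set: X].
Variable phi : flow R X.

Lemma compactX (K : set X) : closed K -> compact K.
Proof. by move=> cK; apply: subclosed_compact cK cptX _. Qed.

Lemma closedX (K : set X) : compact K -> closed K.
Proof. by apply: compact_closed; exact: metric_hausdorff. Qed.

Lemma closed_flow_seg s s' (A : set X) : closed A ->
  closed (flow_seg phi s s' A).
Proof.
move=> cA; apply: closedX.
have -> : flow_seg phi s s' A =
    (fun p : R * X => phi p.1 p.2) @` (`[s, s'] `*` A).
  apply/seteqP; split=> [_ [t ts [a Aa <-]]|_ [[t a] [/= ts Aa] <-]].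
    by exists (t, a).
  by exists t => //; exists a.
apply: continuous_compact.
  by apply: continuous_subspaceT; exact: act_continuous.
by apply: compact_setX; [exact: segment_compact|exact: compactX].
Qed.

Lemma act_compact_near t (K W : set X) : closed K -> open W ->
  phi t @` K `<=` W ->
  exists2 d, 0 < d & forall s, `|t - s| < d -> phi s @` K `<=` W.
Proof.
move=> /compactX/compact_near_coveringP cK oW KW.
have cover x : K x -> \forall y \near x & s \near t, W (phi s y).
  move=> Kx; have /act_near[[A B] /= [tA xB] AB] : nbhs (phi t x) W.
    by apply: open_nbhs_nbhs; split => //; apply: KW; exists x.
  by exists (B, A) => // -[y s] [/= By As]; exact: (AB (s, y)).
have /nbhs_ballP[d /= d0 dW] :
    nbhs t [set s | K `<=` (fun y => W (phi s y))] 
  by exact: (cK R (nbhs t) (fun s y => W (phi s y)) (nbhs_filter t) cover).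
by exists d => // s /dW sW _ [x Kx <-]; exact: sW.
Qed.

Variable tau : R.
Hypothesis tau_neq0 : tau != 0.

Let T := phi tau.

(** * Limits of empirical means along the flow *)

Section Average.
Variables (q : nat) (xs : nat -> X).
Hypothesis q_gt0 : (0 < q)%N.

(* The n-th empirical mean is taken along the times j * step n, j < len n: they
   run over n.+1 periods of T, with q * n.+1 points in each of them. *)
Let mesh n := (q * n.+1)%N.
Let step n := tau / (mesh n)%:R.
Let len n := (n.+1 * mesh n)%N.
Let emp n (A : set X) : R := visits R (phi (step n)) A (len n) (xs n) / (len
  n)%:R.

Let mesh_gt0 n : (0 < mesh n)%N. Proof. by rewrite muln_gt0 q_gt0. Qed.

Let len_gt0 n : 0 < (len n)%:R :> R.
Proof. by rewrite ltr0n muln_gt0 mesh_gt0. Qed.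

Let iter_mesh n : iter (mesh n) (phi (step n)) =1 T.
Proof.
move=> x; rewrite iter_act /step mulrC divfK//.
by rewrite pnatr_eq0 -lt0n.
Qed.

Let emp_ge0 n A : 0 <= emp n A.
Proof. by rewrite divr_ge0 ?visits_ge0// ltW. Qed.

Let emp_le1 n A : emp n A <= 1.
Proof. by rewrite ler_pdivrMr// mul1r visits_le. Qed.

Let emp_le n A B : A `<=` B -> emp n A <= emp n B.
Proof. by move=> AB; rewrite ler_wpM2r ?le_visits// invr_ge0 ltW. Qed.

(** Each visit of [T] to [D] opens a period of [mesh n] sample points. The first n + 1 of them are
    at flow time at most |tau| / q <= eps from the visit, hence in the thickening of [D]; they form
    the fraction 1 / q of the period. *)
Let emp_ge n D eps c : `|tau| <= q%:R * eps ->
  c * n.+1%:R <= visits R T D n.+1 (xs n) ->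
  c / q%:R <= emp n (flow_seg phi (- eps) eps D).
Proof.
move=> qeps cD; set L := flow_seg _ _ _ _.
have qR : 0 < q%:R :> R by rewrite ltr0n.
have nR : 0 < n.+1%:R :> R by rewrite ltr0n.
have -> : c / q%:R = (n.+1%:R * (c * n.+1%:R)) / (len n)%:R.
  rewrite /len /mesh !natrM; apply/eqP; rewrite eqr_div ?mulf_neq0 ?lt0r_neq0//.
  by apply/eqP; move: (n.+1%:R : R) (q%:R : R) => N Q; lra.
rewrite ler_pM2r ?invr_gt0// visits_mulD.
have stepL y : n.+1%:R * \1_D y <= visits R (phi (step n)) L (mesh n) y.
  rewrite indicE; have [/set_mem Dy|_] := boolP (y \in D); last first.
    by rewrite mulr0 visits_ge0.
  rewrite mulr1 /mesh -(prednK q_gt0) mulSn visitsD visits_full.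
    by rewrite lerDl visits_ge0.
  move=> i ni; rewrite iter_act; exists (i%:R * step n); last by exists y.
  rewrite /= in_itv/= -ler_norml /step normrM normrM normfV !normr_nat /mesh.
  rewrite mulrA ler_pdivrMr; last by rewrite natrM mulr_gt0.
  apply: (@le_trans _ _ (n.+1%:R * (q%:R * eps))).
    by rewrite ler_pM// ler_nat ltnW.
  by rewrite natrM; move: (n.+1%:R : R) (q%:R : R) => N Q; lra.
apply: (@le_trans _ _ (n.+1%:R * visits R T D n.+1 (xs n))).
  by rewrite ler_wpM2l.
rewrite /visits big_mkord mulr_sumr; apply: ler_sum => i _.
have -> : iter i T (xs n) = iter (i * mesh n) (phi (step n)) (xs n).
  by rewrite iterM; apply: eq_iter => y; rewrite iter_mesh.
exact: stepL.
Qed.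

Variable om : set_system nat.
Hypotheses (om_ultra : UltraFilter om) (om_oo : \oo `<=` om).

Let om_proper : ProperFilter om. Proof. exact: ultra_proper. Qed.

(** Along an ultrafilter the means converge for every set at once, which makes [lam] a finitely
    additive content on all subsets. *)
Let lam A : R := lim (emp n A @[n --> om]).

Let emp_cvg A : cvg (emp n A @[n --> om]).
Proof. by apply: (@ultra_bounded_cvg _ _ _ _ 0 1) => // n;
  rewrite emp_ge0 emp_le1. Qed.

Let lam_cst (c : R) A : (forall n, emp n A = c) -> lam A = c.
Proof.
by move=> Ac; rewrite /lam (eq_fun Ac) lim_cst.
Qed.

Let lam0 : lam set0 = 0.
Proof.
apply: lam_cst => n; rewrite /emp /visits big1 ?mul0r// => i _.
by rewrite indicE in_set0.
Qed.

Let lamT : lam setT = 1.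
Proof. by apply: lam_cst => n; rewrite /emp visits_full// divff// gt_eqF. Qed.

Let le_lam : {homo lam : A B / A `<=` B >-> A <= B}.
Proof. by move=> A B AB; apply: ler_lim => //; apply: nearW => n;
  exact: emp_le. Qed.

Let lamD A B : lam A + lam B = lim (emp n A + emp n B @[n --> om]).
Proof. by rewrite limD. Qed.

Let lamU A B : lam (A `|` B) <= lam A + lam B.
Proof.
rewrite lamD; apply: ler_lim => //; first exact: is_cvgD.
apply: nearW => n; rewrite -mulrDl ler_wpM2r ?visits_leU// invr_ge0 ltW//.
Qed.

Let lamDU A B : A `&` B = set0 -> lam A + lam B <= lam (A `|` B).
Proof.
move=> AB; rewrite lamD; apply: ler_lim => //; first exact: is_cvgD.
apply: nearW => n; rewrite -mulrDl ler_wpM2r ?invr_ge0 ?(ltW (len_gt0 n))//.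
rewrite /visits -big_split /=; apply: ler_sum => i _; rewrite !indicE in_setU.
have [Ai|_] /= := boolP (_ \in A); last by rewrite add0r.
have [Bi|_] /= := boolP (_ \in B); last by rewrite addr0.
by move/seteqP: AB => [/(_ _ (conj (set_mem Ai) (set_mem Bi)))].
Qed.

Let lam_near_le A B :
  (forall e, 0 < e -> \forall n \near om, emp n A <= emp n B + e) ->
  lam A <= lam B.
Proof.
move=> AB; apply/ler_addgt0Pr => e e0.
have cvg_e : cvg (e @[_ --> om]) by apply/cvg_ex; exists e; exact: cvg_cst.
have -> : lam B + e = lim (emp n B + e @[n --> om]) by rewrite limD// lim_cst.
by apply: ler_lim; [exact: emp_cvg|exact: is_cvgD|exact: AB].
Qed.

Let emp_shift n j (A B : set X) : A `<=` iter j (phi (step n)) @^-1` B \/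
  iter j (phi (step n)) @^-1` A `<=` B ->
    emp n A <= emp n B + j%:R / (len n)%:R.
Proof.
move=> AB; rewrite -mulrDl ler_wpM2r ?invr_ge0 ?(ltW (len_gt0 n))//.
case: AB => [/(le_visits (R := R) (phi (step n)) (len n) (xs n))|
             /(le_visits (R := R) (phi (step n)) (len n) (xs n))].
  have := visits_iter_shift R (phi (step n)) B j (len n) (xs n).
  rewrite ler_norml => /andP[_]; lra.
have := visits_iter_shift R (phi (step n)) A j (len n) (xs n).
rewrite ler_norml => /andP[]; lra.
Qed.

Let near_om_invn (a e : R) : 0 < e -> \forall n \near om, a / n.+1%:R < e.
Proof.
move=> e0; apply: om_oo; exists (Num.truncn (a / e)) => // n /= an.
rewrite ltr_pdivrMr ?ltr0n// mulrC -ltr_pdivrMr//.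
by apply: lt_le_trans (truncnS_gt _) _; rewrite ler_nat.
Qed.

(** The time [t] is approximated, up to sign, by a multiple [j] of the sampling step; the openness
    of [W] absorbs the error, and shifting by [j] samples changes the mean by at most j / len n,
    which tends to 0. *)
Let lam_shift t K W L : closed K -> open W -> phi t @` K `<=` W -> W `<=` L ->
  lam K <= lam L.
Proof.
move=> cK oW KW WL; have [d d0 dW] := act_compact_near cK oW KW.
apply: lam_near_le => e e0; near=> n.
pose j := Num.truncn (`|t| / `|step n|).
have step0 : 0 < `|step n| by rewrite normr_gt0 mulf_neq0// invr_eq0 gt_eqF//
  ltr0n.
have := @truncn_itv _ (`|t| / `|step n|); rewrite divr_ge0// -/j => /(_ isT).
move=> /andP[jle jgt].
have j_len : j%:R / (len n)%:R < e.
  apply: (@le_lt_trans _ _ (`|t| / `|tau| / n.+1%:R)); last first.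
    by near: n; exact: near_om_invn.
  rewrite ler_pdivrMr//; apply: (le_trans jle).
  rewrite /step normf_div normr_nat invf_div /len natrM !mulrA divfK//.
  by rewrite mulrAC.
have dist_step : `|(`|t| - j%:R * `|step n|)| < d.
  apply: (@le_lt_trans _ _ `|step n|).
    rewrite ger0_norm ?subr_ge0 -?ler_pdivlMr// lerBlDr.
    by rewrite ltr_pdivrMr// -natr1 mulrDl mul1r addrC in jgt; exact: ltW.
  apply: (@le_lt_trans _ _ (`|tau| / n.+1%:R)); last first.
    by near: n; exact: near_om_invn.
  rewrite normf_div normr_nat ler_wpM2l// lef_pV2 ?posrE ?ltr0n//.
  by rewrite ler_nat leq_pmull.
apply: (@le_trans _ _ (emp n L + j%:R / (len n)%:R));
  last by rewrite lerD2l ltW.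
apply: emp_shift.
(* As [j] is a natural number, the samples are shifted forward when [t] and the step have the same
   sign and backward otherwise. *)
have [tstep|tstep] := leP 0 (t * step n).
  left=> x Kx /=; rewrite iter_act; apply/WL/(dW (j%:R * step n)).
    move: dist_step; case: (ltgtP (step n) 0) step0 tstep => [s0|s0|->] s1;
      last by rewrite normr0 ltxx in s1.
    - rewrite nmulr_lge0// => t0; rewrite (ler0_norm t0) (ltr0_norm s0).
      by rewrite mulrN opprK addrC distrC.
    - rewrite pmulr_lge0// => t0; by rewrite (ger0_norm t0) (gtr0_norm s0).
  by exists x.
right=> x /= Kx; apply/WL/(dW (- (j%:R * step n))).
  move: dist_step; case: (ltgtP (step n) 0) tstep => [s0|s0|->].
  - rewrite nmulr_llt0// => t0; rewrite (gtr0_norm t0) (ltr0_norm s0).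
    by rewrite mulrN opprK.
  - rewrite pmulr_llt0// => t0; rewrite (ltr0_norm t0) (gtr0_norm s0).
    by rewrite -opprD normrN opprK.
  - by rewrite mulr0 ltxx.
by exists (iter j (phi (step n)) x) => //; rewrite iter_act actK.
Unshelve. all: by end_near. Qed.

Lemma exists_invariant_probability (x0 : X) D eps c :
  `|tau| <= q%:R * eps -> closed D ->
  (forall n, c * n.+1%:R <= visits R T D n.+1 (xs n)) ->
  exists2 mu : probability (borel x0) R, flow_invariant phi mu &
    ((c / q%:R)%:E <= mu (flow_seg phi (- eps) eps D))%E.
Proof.
move=> qeps cD cDn.
have [mu [lam_mu mu_inv]] := exists_content_probability
  (@metric_hausdorff R X) cptX lam0 le_lam lamU lamDU lamT x0.
have mu_le t (A : set X) : (mu (phi t @^-1` A) <= mu A)%E.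
  apply: mu_inv => [|U oU]; first exact: act_continuous_space.
  apply: inner_le => K cK KU.
  have KU' : phi t @` K `<=` U by move=> _ [x /KU Ux <-].
  have cK' : closed (phi t @` K).
    apply: closedX; apply: continuous_compact; last exact: compactX.
    by apply: continuous_subspaceT; exact: act_continuous_space.
  have [W [L [oW cL KW WL LU]]] :=
    compact_hausdorff_closed_nbhd R (@metric_hausdorff R X) cptX cK' oU KU'.
  apply: (@le_trans _ _ (lam L)%:E); last exact: le_inner_closed.
  by rewrite lee_fin; exact: lam_shift KW WL.
exists mu.
  move=> t A _; apply/eqP; rewrite eq_le mu_le /=.
  (* The inequality for the time - t gives the reverse one for [t]. *)
  have {1}-> : A = phi (- t) @^-1` (phi t @^-1` A); last exact: mu_le.
  by apply/seteqP; split => x; rewrite /= actNK.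
have := lam_mu _ (@closed_flow_seg (- eps) eps _ cD); apply: le_trans.
rewrite lee_fin; apply: limr_ge => //; apply: nearW => n.
exact: emp_ge.
Qed.

End Average.

(* If orbits of T visited D with positive frequency, then a limit of empirical
   measures along the flow would charge flow_seg D. *)
Lemma null_ocap eps D : 0 < eps -> closed D ->
  null phi (flow_seg phi (- eps) eps D) -> ocap R T D = 0.
Proof.
move=> eps0 cD nD; apply/eqP/negPn/negP => D0.
have c0 : 0 < ocap R T D by rewrite lt_neqAle eq_sym D0 ocap_ge0.
have [x0 Dx0] : exists x, D x.
  apply/set0P/negP => /eqP D_0; move: D0; rewrite D_0.
  by rewrite ocap_set0 eqxx.
(* The capacity is at most every ratio, so a point with the maximal number of visits in n + 1 steps
   has at least this frequency. *)
have /choice[xs xsP] n : exists x, ocap R T D * n.+1%:R <= visits R T D n.+1 x.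
  have [x xmax] := max_visits_attained R T D n.+1 x0; exists x.
  have := @ocap_le_ratio R _ T D _ (ltn0Sn n).
  by rewrite xmax mulrC ler_pdivlMr ?ltr0n// mulrC.
have [om [om_ultra om_oo]] := ultraFilterLemma (eventually_filter).
pose q := (Num.truncn (`|tau| / eps)).+1.
have qeps : `|tau| <= q%:R * eps.
  by rewrite -ler_pdivrMr// ltW// truncnS_gt.
have [mu mu_inv mu_ge] :=
  exists_invariant_probability (ltn0Sn _) om_ultra om_oo x0 qeps cD xsP.
have := nD x0 mu mu_inv.
rewrite negligibleP; last first.
  rewrite -[X in measurable X]setCK; apply: measurableC.
  by apply: open_measurable_borel; apply: closed_openC; exact: closed_flow_seg.
move=> mu0; move: mu_ge; rewrite mu0 lee_fin leNgt divr_gt0// ltr0n.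
Qed.

End KrylovBogoliubov.

(** * Existence of cross-sections *)

Section LocalTime.
Context {R : realType} {X : metricType R}.

Lemma mdist_continuous (x : X) : continuous (mdist x : X -> R).
Proof.
move=> y; apply/cvgrPdist_lt => e e0.
have : nbhs y (ball y e) by exact: nbhsx_ballx.
apply: filterS => z; rewrite ballEmdist /= => yz.
have := metric_triangle x y z; have := metric_triangle x z y.
rewrite (metric_sym z y) ltr_norml; move: yz.
set a := mdist _ _; set b := mdist _ _; set c := mdist _ _ => h1 h2 h3; lra.
Qed.

Variable phi : flow R X.

(* theta is obtained from the sup of - mdist x (phi t y) - L * t over a window
   of times: near x the sup is attained well inside the window, so that moving
   y along the flow only shifts it by L * s. *)
Lemma exists_local_time x : (exists t, phi t x <> x) ->
  exists theta : X -> R, [/\ continuous theta, theta x = 0 &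
    exists2 eta, 0 < eta & \forall y \near x, forall s, `|s| <= eta ->
      theta (phi s y) = theta y + s].
Proof.
move=> [t tx].
have [c c0 [cx Ncx]] : exists2 c, 0 < c & phi c x != x /\ phi (- c) x != x.
  have Nt : phi (- t) x <> x by move=> h; apply: tx; rewrite -{1}h actNK.
  have [t0|t0|t0] := ltgtP t 0; last by case: tx; rewrite t0 act0.
    by exists (- t); rewrite ?oppr_gt0// opprK; split; exact/eqP.
  by exists t => //; split; exact/eqP.
pose f := mdist x : X -> R.
pose d := Num.min (f (phi c x)) (f (phi (- c) x)).
have d0 : 0 < d by rewrite lt_min !mdist_gt0 eq_sym cx eq_sym.
have cf : continuous f by exact: mdist_continuous.
have cfphi s y : {for (s, y), continuous (fun p : R * X => f (phi p.1 p.2))}.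
  by apply: continuous_comp; [exact: act_continuous|exact: cf].
have dl : d <= f (phi c x) by rewrite ge_min lexx.
have dr : d <= f (phi (- c) x) by rewrite ge_min lexx orbT.
have near_end e : d <= f (phi e x) ->
    \forall s \near 0 & y \near x, d / 2 < f (phi (e + s) y).
  move=> de.
  have d20 : 0 < d / 2 by rewrite divr_gt0.
  have /cvgrPdist_lt/(_ _ d20)[[A B] /= [eA xB] AB] := cfphi e x.
  exists ([set s | A (e + s)], B) => /= [|[s y] [/= As By]].
    split=> //; have /nbhs_ballP[r /= r0 rA] := eA.
    apply/nbhs_ballP; exists r => // s /=; rewrite /ball/= sub0r => sr.
    by apply: rA; rewrite /ball/= opprD addNKr.
  have := AB (e + s, y) (conj As By); rewrite /= ltr_norml => /andP[_].
  by move: de; set a := f _; set b := f _ => h1 h2; lra.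
have [[A1 B1] [/= A1n B1n] AB1] := near_end c dl.
have [[A2 B2] [/= A2n B2n] AB2] := near_end (- c) dr.
have /nbhs_ballP[e /= e0 eA] : nbhs 0 (A1 `&` A2) by exact: filterI.
pose eta := Num.min (e / 2) c.
have eta0 : 0 < eta by rewrite lt_min divr_gt0.
have eta_c : eta <= c by rewrite ge_min lexx orbT.
have etaA s : `|s| <= eta -> A1 s /\ A2 s.
  move=> seta; apply: eA; rewrite /ball/= sub0r normrN.
  apply: (le_lt_trans seta); have : eta <= e / 2 by rewrite ge_min lexx.
  move=> h; lra.
(* With this slope the drift [L * u] is at most d / 8 for |u| <= 2 c, small against the distance
   reached at the ends of the window. *)
pose L := d / (16%:R * c).
have L0 : 0 < L by rewrite divr_gt0// mulr_gt0.
have Lc : L * c = d / 16%:R.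
  by rewrite /L invfM mulrA -mulrA mulVf ?mulr1// gt_eqF.
pose q y u := - f (phi u y) - L * u.
pose G y := sup [set q y u | u in `[- c, c]].
have supG y : has_sup [set q y u | u in `[- c, c]].
  split; first by exists (q y 0), 0 => //=; rewrite in_itv/= oppr_le0 ltW.
  exists (L * c) => _ [u /= uc <-]; rewrite /q.
  have : 0 <= f (phi u y) by exact: mdist_ge0.
  have : L * - c <= L * u.
    by rewrite ler_pM2l//; move: uc; rewrite in_itv/= => /andP[].
  by rewrite mulrN; set a := f _; move=> h1 h2; lra.
have qG y u : `|u| <= c -> q y u <= G y.
  by move=> uc; apply: sup_upper_bound => //; exists u => //=;
    rewrite in_itv/= -ler_norml.
have Gle y b : (forall u, `|u| <= c -> q y u <= b) -> G y <= b.
  move=> h; apply: ge_sup; first by case: (supG y).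
  by move=> _ [u /= uc <-]; apply: h; rewrite ler_norml; rewrite in_itv/= in uc.
have cG : continuous G.
  move=> y0; apply/cvgrPdist_le => r r0.
  have /compact_near_coveringP cpt : compact `[- c,
    c] by exact: segment_compact.
  have : nbhs y0 [set y | `[- c, c] `<=`
      (fun u => `|f (phi u y0) - f (phi u y)| < r)].
    apply: (cpt X (nbhs y0) (fun y u => `|f (phi u y0) - f (phi u y)| < r) _ _).
    move=> u _; have r20 : 0 < r / 2 by rewrite divr_gt0.
    have /cvgrPdist_lt/(_ _ r20)[[A B] /= [Au By0] AB] := cfphi u y0.
    exists (A, B) => // -[v y] [/= Av By].
    have := AB (v, y) (conj Av By);
      have := AB (v, y0) (conj Av (nbhs_singleton By0)).
    rewrite /= !ltr_norml; set a1 := f _; set a2 := f _; set a3 := f _.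
    by move=> /andP[? ?] /andP[? ?]; lra.
  apply: filterS => y yr.
  have fr u : `|u| <= c -> `|q y0 u - q y u| <= r.
    rewrite ler_norml => uc; have := yr u; rewrite /= in_itv/= => /(_ uc).
    rewrite distrC => /ltW; rewrite /q; congr (`|_| <= _).
    by set a := f _; set b := f _; lra.
  have : G y0 <= G y + r.
    apply: Gle => u uc; have := qG y u uc; have := fr u uc.
    rewrite ler_norml; set a := q _ _; set b := q _ _; set g := G _.
    by move=> /andP[? ?] ?; lra.
  have : G y <= G y0 + r.
    apply: Gle => u uc; have := qG y0 u uc; have := fr u uc.
    rewrite ler_norml; set a := q _ _; set b := q _ _; set g := G _.
    by move=> /andP[? ?] ?; lra.
  rewrite ler_norml; set g := G _; set g' := G _ => h1 h2; lra.
exists (fun y => (G y - G x) / L); split.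
- by move=> y; apply: cvgM; [apply: cvgB;
    [exact: cG|exact: cvg_cst]|exact: cvg_cst].
- by rewrite subrr mul0r.
exists eta => //; near=> y.
have B1y : B1 y by near: y.
have B2y : B2 y by near: y.
have fy : f y <= d / 8%:R.
  near: y; have /cvgr_le := cf x; apply.
  by rewrite /f mdistxx divr_gt0.
(* Near both ends of the window the orbit is more than d / 2 away from [x], while at time 0 it is
   within d / 8; the drift, at most d / 8, cannot compensate. *)
have edge u : c - eta <= `|u| <= c + eta -> q y u <= q y 0.
  move=> /andP[ul uu].
  have Lu : - (d / 8%:R) <= L * u.
    have : L * - (c + eta) <= L * u.
      by rewrite ler_pM2l//; move: uu; rewrite ler_norml => /andP[].
    have : L * eta <= L * c by rewrite ler_pM2l.
    rewrite mulrN mulrDr Lc; set a := L * u; set b := L * eta => h1 h2; lra.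
  have fu : d / 2 < f (phi u y).
    have [u0|u0] := leP 0 u.
      rewrite ger0_norm// in ul uu.
      have [] := etaA (u - c); first by rewrite ler_norml; apply/andP; split;
        lra.
      by move=> A1u _; have := AB1 (u - c, y) (conj A1u B1y);
        rewrite /= addrC subrK.
    rewrite ltr0_norm// in ul uu.
    have [] := etaA (u + c); first by rewrite ler_norml; apply/andP; split; lra.
    by move=> _ A2u; have := AB2 (u + c, y) (conj A2u B2y);
      rewrite /= addrC addrK.
  rewrite /q act0 mulr0; move: fu Lu fy; set a := f _; set b := L * u;
    set g := f y.
  by move=> h1 h2 h3; lra.
move=> s seta; suff -> : G (phi s y) = G y + L * s.
  by rewrite -addrAC mulrDl mulrAC divff ?mul1r// gt_eqF.
(* Moving [y] by [s] translates the window and adds [L * s]. The times by which the two windows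
   differ are near their ends, where [edge] applies. *)
have qs u : q (phi s y) u = q y (u + s) + L * s.
  by rewrite /q -actD mulrDr; set a := f _; lra.
have s_c : `|s| <= c by exact: le_trans eta_c.
apply/eqP; rewrite eq_le; apply/andP; split.
  apply: Gle => u uc; rewrite qs lerD2r.
  have [usc|usc] := leP `|u + s| c; first exact: qG.
  apply: le_trans (edge _ _) _; last by apply: qG; rewrite normr0 ltW.
  rewrite (le_trans _ (ltW usc)) ?lerBlDr ?lerDl ?(ltW eta0)//=.
  by apply: le_trans (ler_normD _ _) _; exact: lerD.
rewrite -lerBrDr; apply: Gle => u uc; rewrite lerBrDr.
have := qs (u - s); rewrite subrK => <-.
have [usc|usc] := leP `|u - s| c; first exact: qG.
have : q y u <= q y 0.
  apply: edge; rewrite (le_trans uc) ?lerDl ?(ltW eta0)// andbT.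
  rewrite lerBlDr (le_trans (ltW usc))//.
  by apply: le_trans (ler_normB _ _) _; exact: lerD.
move=> h; apply: (@le_trans _ _ (q y 0 + L * s));
  first by rewrite qs subrK lerD2r.
have := qs (- s); rewrite addNr => <-.
by apply: qG; rewrite normrN.
Unshelve. all: by end_near. Qed.

Lemma closed_mdist_ball (x : X) r : closed [set y | mdist x y <= r].
Proof.
apply: (@preimage_closed _ _ (mdist x) [set z | z <= r]); last exact: closed_le.
by move=> y _; exact: mdist_continuous.
Qed.

Lemma nbhs_mdist_ball (x : X) (U : set X) : nbhs x U ->
  exists2 r, 0 < r & [set y | mdist x y <= r] `<=` U.
Proof.
move=> /nbhs_ballP[e /= e0 eU]; exists (e / 2); first by rewrite divr_gt0.
move=> y /= xy; apply: eU; rewrite ballEmdist /=; lra.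
Qed.

Lemma mdist_ball_nbhs (x : X) r : 0 < r -> nbhs x [set y | mdist x y <= r].
Proof.
move=> r0; have := nbhsx_ballx x r r0; apply: filterS => y.
by rewrite ballEmdist => /ltW.
Qed.

(** The section is the zero set of a local time in a small ball around [x]: a point [y] near [x]
    reaches it at time [- theta y]. *)
Lemma exists_cross_section x (U : set X) : (exists t, phi t x <> x) ->
  nbhs x U -> exists eta S, [/\ closed S, cross_section phi eta S,
    flow_int phi eta S x & S `<=` U].
Proof.
move=> /exists_local_time[theta [ctheta theta_x [eta2 eta20 thetaS]]] xU.
have [r r0 rU] := nbhs_mdist_ball (filterI xU thetaS).
pose S := [set y | theta y = 0] `&` [set y | mdist x y <= r].
(* Two times in [- eta, eta] differ by at most [eta2], the range in which [theta] grows at unit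
   speed; since [theta] vanishes on [S], injectivity follows. *)
pose eta := eta2 / 2.
have eta0 : 0 < eta by rewrite divr_gt0.
have etaE : eta2 = eta + eta by rewrite -splitr.
exists eta, S; split.
- apply: closedI; last exact: closed_mdist_ball.
  apply: (@preimage_closed _ _ theta [set 0]); first by move=> y _;
    exact: ctheta.
  exact: closed_eq.
- split=> // -[t y] [t' y'] /set_mem[/= ht [y0 yr]] /set_mem[/= ht' [y'0 y'r]]
    tyt'.
  have y'E : y' = phi (t - t') y by rewrite addrC actD tyt' actK.
  have [_ /(_ (t - t'))] := rU _ yr.
  rewrite -y'E y0 y'0 add0r => tt'; have {}tt' : t = t'.
    apply/eqP; rewrite -subr_eq0 -tt'//.
    move: ht ht'; rewrite !in_itv/= => /andP[? ?] /andP[? ?].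
    rewrite ler_norml etaE; apply/andP; split; lra.
  by rewrite y'E tt' subrr act0.
- have Sx : S x by split => //=; rewrite mdistxx ltW.
  split=> //; rewrite /interior/=.
  have /act_near[[A B] /= [A0 Bx] AB] : nbhs (phi 0 x) [set y | mdist x y <= r].
    by rewrite act0; exact: mdist_ball_nbhs.
  have [e /= e0 eA] := iffLR (nbhs_ballP _ _) A0.
  near=> y.
  have ty_e : `|theta y| < e.
    near: y; have /cvgrPdist_lt/(_ _ e0) := ctheta x.
    by rewrite theta_x; apply: filterS => y; rewrite sub0r normrN.
  have ty_eta : `|theta y| <= eta.
    near: y; have /cvgrPdist_le/(_ _ eta0) := ctheta x.
    by rewrite theta_x; apply: filterS => y; rewrite sub0r normrN.
  exists (theta y); first by rewrite /= in_itv/= -ler_norml.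
  exists (phi (- theta y) y); last by rewrite actNK.
  have yS : forall s, `|s| <= eta2 -> theta (phi s y) = theta y + s by near: y.
  split; rewrite /=.
    rewrite yS ?subrr// normrN (le_trans ty_eta)// etaE; lra.
  apply: (AB (- theta y, y)); split => /=; last by near: y.
  by apply: eA; rewrite /ball/= sub0r opprK.
- by move=> y [_ /rU[]].
Unshelve. all: by end_near. Qed.

End LocalTime.

(** * Geometry of cross-sections *)

Section NullSets.
Context {R : realType} {X : metricType R}.
Variable phi : flow R X.

Lemma nullS (A B : set X) : A `<=` B -> null phi B -> null phi A.
Proof. by move=> AB nB x0 mu /nB; exact: negligibleS. Qed.

Lemma null_bigsetU (I : Type) (s : seq I) (F : I -> set X) :
  (forall i, null phi (F i)) -> null phi (\big[setU/set0]_(i <- s) F i).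
Proof.
move=> nF; elim: s => [|i s IH] x0 mu mu_inv.
  by rewrite big_nil; exact: negligible_set0.
by rewrite big_cons; apply: negligibleU; [exact: nF|exact: IH].
Qed.

Lemma flow_segS s s' (A B : set X) :
  A `<=` B -> flow_seg phi s s' A `<=` flow_seg phi s s' B.
Proof. by move=> AB _ [t ts [a /AB Ba <-]]; exists t => //; exists a. Qed.

Lemma flow_seg_comp e e' (A : set X) :
  flow_seg phi (- e) e (flow_seg phi (- e') e' A) `<=`
  flow_seg phi (- (e + e')) (e + e') A.
Proof.
move=> _ [t te [_ [t' te' [a Aa <-]] <-]].
exists (t + t'); last by exists a => //; rewrite actD.
move: te te'; rewrite /= !in_itv/= => /andP[? ?] /andP[? ?].
by apply/andP; split; lra.
Qed.

End NullSets.

Section CrossSection.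
Context {R : realType} {X : metricType R}.
Hypothesis cptX : compact [set: X].
Variable phi : flow R X.
Implicit Types (eta : R) (S E W : set X).

Lemma cross_section_inj eta S t t' y y' : cross_section phi eta S ->
  `|t| <= eta -> `|t'| <= eta -> S y -> S y' -> phi t y = phi t' y' ->
  t = t' /\ y = y'.
Proof.
move=> [_ injS] ht ht' Sy Sy' e.
have mem u z : `|u| <= eta -> S z -> (u, z) \in `[- eta, eta] `*` S.
  by move=> hu Sz; apply/mem_set; split => //=; rewrite in_itv/= -ler_norml.
by have [-> ->] := injS _ _ (mem t y ht Sy) (mem t' y' ht' Sy') e.
Qed.

Lemma cross_section_flow_seg eta S E y : cross_section phi eta S -> E `<=` S ->
  S y -> flow_seg phi (- eta) eta E y -> E y.
Proof.
move=> cS ES Sy [t te [a Ea aty]].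
have [| | | | |_ -> //] := @cross_section_inj eta S 0 t y a cS.
- by rewrite normr0 ltW//; case: cS.
- by rewrite ler_norml; rewrite /= in_itv/= in te.
- by [].
- exact: ES.
- by rewrite act0.
Qed.

(** Flowing [y] forward and its image backward by t / 2 gives the same point, with both times in the
    injectivity window. *)
Lemma cross_section_time eta S t y : cross_section phi eta S ->
  S y -> S (phi t y) -> `|t| <= eta + eta -> t = 0.
Proof.
move=> cS Sy Sty tee.
have t2 : `|t / 2| <= eta.
  by rewrite normrM [`|2^-1|]gtr0_norm ?invr_gt0// ler_pdivrMr// mulr_natr
    mulr2n.
have [| | | |] := @cross_section_inj eta S (t / 2) (- (t / 2)) y (phi t y) cS
  t2.
- by rewrite normrN.
- by [].
- by [].
- by rewrite -actD; congr (phi _ y); lra.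
by move=> h _; lra.
Qed.

Lemma closed_act_image (K : set (R * X)) : compact K ->
  closed ((fun p : R * X => phi p.1 p.2) @` K).
Proof.
move=> cK; apply: closedX; apply: continuous_compact => //.
by apply: continuous_subspaceT; exact: act_continuous.
Qed.

(** The pairs (time, base point) outside the small box around (0, x) form a compact set [K] whose
    image misses [x] by injectivity. Points close enough to [x] thus come only from the small
    box. *)
Lemma flow_int_nbhs eta S x e W : closed S -> cross_section phi eta S ->
  flow_int phi eta S x -> 0 < e -> nbhs x W ->
  nbhs x (flow_seg phi (- e) e (S `&` W)).
Proof.
move=> cS csS [xS Sx] e0 xW; have eta0 : 0 < eta by case: csS.
pose small : set (R * X) := [set t : R | `|t| < e] `*` interior W.
pose K := (`[- eta, eta] `*` S) `\` small.
have cK : compact K.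
  apply: compact_closedI.
    by apply: compact_setX; [exact: segment_compact|exact: compactX].
  apply: open_closedC; apply: openI.
    apply: open_comp; first by move=> p _; exact: cvg_fst.
    have -> : [set t : R | `|t| < e] = ball 0 e.
      by apply/seteqP; split => t /=; rewrite /ball/= sub0r normrN.
    exact: ball_open.
  apply: open_comp; last exact: open_interior.
  by move=> p _; exact: cvg_snd.
have Kx : ~ ((fun p : R * X => phi p.1 p.2) @` K) x.
  move=> [[t s] [[/= ht Ss] nsmall] tsx].
  have [| | | | |t0 sx] := @cross_section_inj eta S t 0 s x csS.
  - by rewrite ler_norml; rewrite in_itv/= in ht.
  - by rewrite normr0 ltW.
  - by [].
  - by [].
  - by rewrite act0.
  apply: nsmall; rewrite t0 sx; split => /=; first by rewrite normr0.
  exact: nbhs_singleton (nbhs_interior xW).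
have : nbhs x (~` ((fun p : R * X => phi p.1 p.2) @` K)).
  apply: open_nbhs_nbhs; split => //.
  by apply: closed_openC; exact: closed_act_image.
move=> /(filterI xS); apply: filterS => y [[t ht [s Ss tsy]] yK].
have [[/= te sW]|nsmall] := pselect (small (t, s)).
  exists t; first by rewrite /= in_itv/= -ler_norml ltW.
  by exists s => //; split => //; exact: interior_subset.
by case: yK; exists (t, s).
Qed.

Lemma flow_int_setI eta S x W : closed S -> cross_section phi eta S ->
  flow_int phi eta S x -> nbhs x W -> flow_int phi eta (S `&` W) x.
Proof.
move=> cS csS Sx xW; split; last by split; [case: Sx|exact: nbhs_singleton].
by apply: (flow_int_nbhs cS csS Sx _ xW); case: csS.
Qed.

Lemma cross_sectionS eta S E : E `<=` S -> cross_section phi eta S ->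
  cross_section phi eta E.
Proof.
move=> ES [eta0 injS]; split => // p q /set_mem[p1 p2] /set_mem[q1 q2].
by apply: injS; apply/mem_set; split => //; exact: ES.
Qed.

Lemma flow_bd_closedE eta E : closed E ->
  flow_bd phi eta E = E `\` interior (flow_seg phi (- eta) eta E).
Proof.
move=> /closure_id cE; rewrite /flow_bd -cE /flow_int.
apply/seteqP; split => y [Ey h]; split => //; first by move=> iy; apply: h.
by move=> [iy _]; apply: h.
Qed.

Lemma closed_flow_bd eta E : closed E -> closed (flow_bd phi eta E).
Proof.
move=> cE; rewrite flow_bd_closedE//; apply: closedI => //.
by apply: open_closedC; exact: open_interior.
Qed.

(** Around each point of [P], SFBP gives a piece of the section that avoids [Q]; finitely many
    pieces cover [P], and the flow boundary of their union lies in the union of their flow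
    boundaries. *)
Lemma small_flow_boundary_separation (sfbp : SFBP phi) eta S P Q :
  closed S -> cross_section phi eta S -> closed P ->
    P `<=` flow_int phi eta S ->
  closed Q -> (forall y, P y -> ~ Q y) ->
  exists E, [/\ closed E, E `<=` S, P `<=` E, forall y, E y -> ~ Q y &
    small_flow_boundary phi eta E].
Proof.
move=> cS csS cP PS cQ PQ.
have piece p : exists E, P p -> [/\ closed E, E `<=` S, forall y, E y -> ~ Q y,
    flow_int phi eta E p & small_flow_boundary phi eta E].
  have [Pp|nPp] := pselect (P p); last by exists set0.
  have pQ : nbhs p (~` Q).
    apply: open_nbhs_nbhs; split; [exact: closed_openC|exact: PQ].
  have [r r0 rQ] := nbhs_mdist_ball pQ.
  have cS' : closed (S `&` [set y | mdist p y <= r]).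
    by apply: closedI => //; exact: closed_mdist_ball.
  have csS' : cross_section phi eta (S `&` [set y | mdist p y <= r]).
    by apply: cross_sectionS csS; exact: subIsetl.
  have pS' := flow_int_setI cS csS (PS _ Pp) (mdist_ball_nbhs p r0).
  have [E [cE ES' pE sE]] := sfbp.2 p eta _ cS' csS' pS'.
  exists E => _; split => // [y /ES'[]//|y /ES'[_] /rQ//].
have {piece}/choice[E EP] := piece.
have [p Pp|s [sP Ps]] := compact_finite_cover
  (f := fun p => interior (flow_seg phi (- eta) eta (E p))) (compactX cptX cP).
  by have [_ _ _ [pE _] _] := EP p Pp; apply: nbhs_interior; exact: pE.
have sE y : (\big[setU/set0]_(p <- s) E p) y -> exists2 p, p \in s & E p y.
  by rewrite -bigcup_seq => -[p ps Ep]; exists p.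
have Es p : p \in s -> E p `<=` \big[setU/set0]_(p <- s) E p.
  by move=> ps y Ey; rewrite -bigcup_seq; exists p.
have cE : closed (\big[setU/set0]_(p <- s) E p).
  rewrite big_seq; apply: big_ind => [|A B cA cB|p /sP/EP[]//].
    exact: closed0.
  exact: closedU.
exists (\big[setU/set0]_(p <- s) E p); split => //.
- by move=> y /sE[p /sP/EP[_ ES _ _ _]] /ES.
- move=> y Py; have [p ps /interior_subset pE] := Ps y Py.
  apply: (Es p ps); have [_ ES _ _ _] := EP p (sP p ps).
  by apply: (cross_section_flow_seg csS ES) pE; case: (PS _ Py).
- by move=> y /sE[p /sP/EP[_ _ EQ _ _]] /EQ.
- pose F p := if p \in s then flow_seg phi (- eta) eta (flow_bd phi eta (E p))
    else set0.
  apply: (@nullS _ _ _ _ (\big[setU/set0]_(p <- s) F p)); last first.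
    apply: null_bigsetU => p; rewrite /F; case: ifPn => [/sP/EP[]//|_].
    by move=> x0 mu _; exact: negligible_set0.
  move=> y [t te [a]]; rewrite flow_bd_closedE// => -[/sE[p ps Ea] ia] <- {y}.
  rewrite -bigcup_seq; exists p => //; rewrite /F ps; exists t => //;
    exists a => //.
  rewrite flow_bd_closedE; last by case: (EP p (sP p ps)).
  split=> // iEa; apply: ia; move: iEa; apply: interiorS; apply: flow_segS.
  exact: Es.
Qed.

End CrossSection.

(** * Perturbation of graphs over a cross-section *)

Section RareNeighbourhoods.
Context {R : realType} {X : metricType R}.
Hypothesis cptX : compact [set: X].

(** Only [n] iterates matter: if [y] is close to [x] and [r] is small, [y] visits the
    r-neighbourhood of [C] only when [x] visits [C]. Compactness makes [r] uniform. *)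
Lemma rare_open_nbhd (T : X -> X) (d : R) (C : set X) : continuous T ->
  closed C ->
  rare d T C -> exists W, [/\ open W, C `<=` W & rare d T W].
Proof.
move=> cT cC [n n0 nC].
pose W (r : R) := [set y | exists2 c, C c & mdist c y < r].
have cTi i : continuous (iter i T).
  elim: i => [|i IH] x; first exact: cvg_id.
  by apply: (continuous_comp (IH x)); exact: cT.
have far i x : \forall y \near x & r \near 0^'+, W r (iter i T y) ->
  C (iter i T x).
  have [Cx|nCx] := pselect (C (iter i T x));
    first by exists (setT, setT) => //=; split; exact: filterT.
  have /nbhs_ballP[e /= e0 eC] : nbhs (iter i T x) (~` C).
    by apply: open_nbhs_nbhs; split => //; exact: closed_openC.
  have e20 : 0 < e / 2 by rewrite divr_gt0.
  exists (iter i T @^-1` ball (iter i T x) (e / 2), [set r | r < e / 2]) => /=.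
    split; first by apply: cTi; exact: nbhsx_ballx.
    exact: nbhs_right_lt.
  move=> [y r] [/=]; rewrite ballEmdist /= => xy re [c Cc cy].
  case: (eC c) => //; rewrite ballEmdist /=.
  apply: (le_lt_trans (metric_triangle _ (iter i T y) _)).
  by rewrite [mdist _ c]metric_sym; move: xy cy; set a := mdist _ _;
    set b := mdist _ _; lra.
have cover x : [set: X] x -> \forall y \near x & r \near 0^'+,
    visits R T (W r) n y <= d * n%:R.
  move=> _; have prodF : Filter (filter_prod (nbhs x) (0 : R)^'+) by exact:
    filter_prod_filter.
  have far_lt m : \forall y \near x & r \near 0^'+, forall i, (i < m)%N ->
      W r (iter i T y) -> C (iter i T x).
    elim: m => [|m IH]; first
      by exists (setT, setT) => //=; split; exact: filterT.
    apply: (@filterS _ _ prodF) (@filterI _ _ prodF _ _ IH (far m x)) => -[y r]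
      /= [h1 h2] i.
    by rewrite ltnS leq_eqVlt => /orP[/eqP -> //|]; exact: h1.
  apply: (@filterS _ _ prodF _ _ _ (far_lt n)) => -[y r] /= h;
    apply: le_trans (nC x).
  rewrite /visits !big_nat; apply: ler_sum => i /andP[_ ni]; rewrite !indicE.
  have [/set_mem Wi|_] := boolP (_ \in W r); last exact: ler0n.
  by rewrite mem_set//; exact: h Wi.
have /compact_near_coveringP cpt := cptX.
have near_rare := cpt R 0^'+ (fun r y => visits R T (W r) n y <= d * n%:R) _
  cover.
have [r [/= r0 rW]] := filter_ex (filterI (nbhs_right_gt 0) (near_rare _)).
exists (W r); split.
- have -> : W r = \bigcup_(c in C) mdist c @^-1` [set z | z < r] by [].
  apply: bigcup_open => c _; apply: open_comp; last exact: open_lt.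
  by move=> y _; exact: mdist_continuous.
- by move=> c Cc; exists c => //; rewrite mdistxx.
- by exists n => // y; exact: rW.
Qed.

Variable phi : flow R X.
Variable tau : R.
Hypothesis tau_neq0 : tau != 0.

(** The thickening by [eps] is itself a closed set whose thickening by eta - eps is null. *)
Lemma null_flow_seg_ocap eta eps D : eps < eta -> closed D ->
  null phi (flow_seg phi (- eta) eta D) ->
  ocap R (phi tau) (flow_seg phi (- eps) eps D) = 0.
Proof.
rewrite -subr_gt0 => ee cD nD.
apply: (null_ocap cptX tau_neq0 ee); first exact: closed_flow_seg.
by apply: nullS nD; apply: (subset_trans (@flow_seg_comp _ _ _ _ _ _));
  rewrite subrK.
Qed.

Lemma null_rare_nbhd eta eps (d : R) D : 0 < d -> eps < eta -> closed D ->
  null phi (flow_seg phi (- eta) eta D) ->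
  exists N, [/\ open N, D `<=` N & rare d (phi tau) (flow_seg phi (- eps) eps
    N)].
Proof.
move=> d0 epseta cD nD.
have cL : closed (flow_seg phi (- eps) eps D) by exact: closed_flow_seg.
have L0 := null_flow_seg_ocap epseta cD nD.
have := @ocap_rare R _ d (phi tau) (flow_seg phi (- eps) eps D).
rewrite L0 => /(_ d0) /(rare_open_nbhd (@act_continuous_space _ _ phi tau) cL).
move=> [W [oW LW rW]].
(* The points whose whole orbit segment stays in [W]. *)
exists (interior [set y | `[- eps, eps] `<=` (fun t => W (phi t y))]); split.
- exact: open_interior.
- move=> y Dy; have /compact_near_coveringP cpt :=
    @segment_compact R (- eps) eps.
  apply: (cpt X (nbhs y) (fun z t => W (phi t z)) (nbhs_filter y)) => t te.
  have /act_near[[A B] /= [tA yB] AB] : nbhs (phi t y) W.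
    by apply: open_nbhs_nbhs; split => //; apply: LW; exists t => //; exists y.
  by exists (A, B) => // -[s z] [/= As Bz]; exact: (AB (s, z)).
- by apply: rareS rW => _ [t te [y /interior_subset Ny <-]]; exact: Ny.
Qed.

End RareNeighbourhoods.

(** * One perturbation, and the limit of countably many *)

Section Perturbation.
Context {R : realType} {X : metricType R}.
Hypothesis cptX : compact [set: X].
Variable phi : flow R X.
Variable tau : R.
Hypothesis tau_neq0 : tau != 0.
Hypothesis sfbp : SFBP phi.
Variables (eta eps : R) (S' S : set X).
Hypothesis eps_gt0 : 0 < eps.
Hypothesis eps_eta : eps + eps <= eta.
Hypothesis closed_S' : closed S'.
Hypothesis cross_S' : cross_section phi eta S'.
Hypothesis closed_S : closed S.
Hypothesis S_flow_int : S `<=` flow_int phi eta S'.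

Definition return_graph k (A B : set X) (g : X -> R) : set X :=
  [set y | exists s s', [/\ (S `&` A) s, (S `&` B) s', y = phi (g s) s &
    iter k (phi tau) y = phi (g s') s']].

(* g s - g (phi t s) - (t - k * tau) vanishes exactly when the k-th iterate
   sends the point of the graph of g over s to the one over phi t s. *)
Let returns k (A B : set X) (g : X -> R) (J : set R) : set X :=
  [set s | (S `&` A) s /\ exists t, [/\ `|t - k%:R * tau| <= eps + eps,
    (S `&` B) (phi t s) & J (g s - g (phi t s) - (t - k%:R * tau))]].

Let closed_returns k A B (g : X -> R) (J : set R) : closed A -> closed B ->
  continuous g -> closed J ->
  closed (returns k A B g J).
Proof.
move=> cA cB cg cJ.
pose h (p : R * X) := g p.2 - g (phi p.1 p.2) - (p.1 - k%:R * tau).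
pose K := (`[k%:R * tau - (eps + eps),
  k%:R * tau + (eps + eps)] `*` (S `&` A)) `&`
  (((fun p : R * X => phi p.1 p.2) @^-1` (S `&` B)) `&` (h @^-1` J)).
have -> : returns k A B g J = snd @` K.
  apply/seteqP; split=> [s [SAs [t [te SBt Jt]]]|_ [[t s] [[/= It SAs] [SBt
    Jt]] <-]].
    exists (t, s) => //; split; first split => //=.
      by rewrite in_itv/= -ler_distl.
    by split.
  split=> //; exists t; split => //.
  by move: It; rewrite in_itv/= ler_distl.
apply: closedX => //; apply: continuous_compact.
  by apply: continuous_subspaceT => p; exact: cvg_snd.
apply: compact_closedI.
  apply: compact_setX; first exact: segment_compact.
  by apply: compactX => //; exact: closedI.
apply: closedI.
  apply: preimage_closed; last exact: closedI.
  by move=> p _; exact: act_continuous.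
apply: preimage_closed => // p _.
have c1 : {for p, continuous (fun q : R * X => g q.2)}.
  by apply: continuous_comp; [exact: cvg_snd|exact: cg].
have c2 : {for p, continuous (fun q : R * X => g (phi q.1 q.2))}.
  by apply: continuous_comp; [exact: act_continuous|exact: cg].
apply: cvgB; first by apply: cvgB; [exact: c1|exact: c2].
by apply: cvgB; [exact: cvg_fst|exact: cvg_cst].
Qed.

(** For a return from s to s' the defect of [g'] is 0. As u vanishes at s', in [B], the defect of
    [g] at s is within e / 4 of - u s. Where u s is e or - e this puts s in [Q] or [P] respectively,
    and the choice of the sign through [E] forbids it. *)
Lemma return_graph_perturbation k A B (g : X -> R) (e d : R) :
  closed A -> closed B -> (forall s, A s -> ~ B s) -> continuous g -> 0 < e ->
    0 < d ->
  exists u : X -> R, [/\ continuous u, forall s, `|u s| <= e &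
    forall g' : X -> R, (forall s, `|g' s| <= eps) ->
      (forall s, `|g' s - (g s + u s)| <= e / 8%:R) ->
      rare d (phi tau) (return_graph k A B g')].
Proof.
move=> cA cB AB cg e0 d0.
pose P := returns k A B g [set z | e / 2 <= z].
pose Q := returns k A B g [set z | z <= - (e / 2)].
have cP : closed P by apply: closed_returns => //; exact: closed_ge.
have cQ : closed Q by apply: closed_returns => //; exact: closed_le.
have PS : P `<=` flow_int phi eta S' by move=> s [[Ss _] _]; exact: S_flow_int.
have SS' : S `<=` S' by move=> s /S_flow_int[].
(* Two admissible times differ by at most 2 eta, so they coincide by [cross_section_time]: the
   defect at [s] has a single value. *)
have PQ s : P s -> ~ Q s.
  move=> [_ [t [te [St _] /= ht]]] [_ [t' [t'e [St' _] /= ht']]].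
  have tt' : t' - t = 0.
    apply: (cross_section_time cross_S' (SS' _ St)).
      by rewrite -actD subrK; exact: SS'.
    have -> : t' - t = (t' - k%:R * tau) - (t - k%:R * tau) by lra.
    by apply: le_trans (ler_normB _ _) _; apply: lerD; exact: le_trans eps_eta.
  have {}tt' : t' = t by apply/eqP; rewrite -subr_eq0 tt'.
  by move: ht'; rewrite tt'; move: ht; move: (g s - _ - _ : R) => z h1 h2; lra.
have [E [cE ES' PE EQ sE]] := small_flow_boundary_separation cptX sfbp
  closed_S' cross_S' cP PS cQ PQ.
have eps_lt : eps < eta by move: eps_gt0 eps_eta => h1 h2; lra.
(* The sign of the perturbation changes near the flow boundary of [E]. Graph points over [N] are
   discarded: as |g'| <= eps, they lie in the rare thickening of [N]. *)
have [N [oN bdN rN]] := null_rare_nbhd cptX tau_neq0 d0 eps_lt (@closed_flow_bd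
  _ _ phi eta _ cE) sE.
pose P1 := (S `&` A) `&` (E `\` N).
pose P2 := (S `&` A) `&` closure (S `\` (E `|` N)).
have cSA : closed (S `&` A) by exact: closedI.
have cP1 : closed P1.
  by apply: closedI => //; apply: closedI => //; exact: open_closedC.
have cP2 : closed P2 by apply: closedI => //; exact: closed_closure.
(* A point of [E] off its flow boundary has a neighbourhood that meets [S] only in [E]. *)
have P12 z : P1 z -> ~ P2 z.
  move=> [_ [Ez nNz]] [_ cz].
  have : ~ flow_bd phi eta E z by move/bdN.
  rewrite flow_bd_closedE// => nbd.
  have intz : interior (flow_seg phi (- eta) eta E) z.
    by apply: contrapT => nz; apply: nbd.
  have [w [[Sw nEw] Ow]] := cz _ intz.
  by apply: nEw; left; exact: (cross_section_flow_seg cross_S' ES' (SS' _ Sw)).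
have bump (F G : set X) : closed F -> closed G -> (forall z, F z -> ~ G z) ->
    exists f : X -> R, [/\ continuous f, forall z, 0 <= f z <= 1,
      forall z, F z -> f z = 1 & forall z, G z -> f z = 0].
  move=> cF cG FG.
  have /(@normal_separatorP R)/(_ G F cG cF) :=
    compact_normal (@metric_hausdorff R X) cptX.
  have GF : G `&` F = set0 by apply/disjoints_subset => z Gz /FG.
  move=> /(_ GF)/(@uniform_separatorP _ R)[f [cf f01 f0 f1]].
  exists f; split => // [z|z Fz|z Gz].
  - by have := f01 (f z) (imageT f z); rewrite /= in_itv.
  - by apply: f1; exists z.
  - by apply: f0; exists z.
have [f1 [cf1 f1b f1F f1G]] : exists f : X -> R, [/\ continuous f,
    forall z, 0 <= f z <= 1, forall z, P1 z -> f z = 1 &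
    forall z, (P2 `|` B) z -> f z = 0].
  apply: bump => //; first exact: closedU.
  by move=> z P1z [/(P12 z P1z)|]//; apply: AB; case: P1z => -[].
have [f2 [cf2 f2b f2F f2G]] : exists f : X -> R, [/\ continuous f,
    forall z, 0 <= f z <= 1, forall z, P2 z -> f z = 1 &
    forall z, (P1 `|` B) z -> f z = 0].
  apply: bump => //; first exact: closedU.
  by move=> z P2z [/P12/(_ P2z)|]//; apply: AB; case: P2z => -[].
(* On A, outside N, adding u to g moves the defect away from 0: it is more than
   - e / 2 on E, which misses Q, and less than e / 2 off E, which contains P. *)
pose u z := e * (f1 z - f2 z); exists u; split.
- move=> z; apply: cvgM; first exact: cvg_cst.
  by apply: cvgB; [exact: cf1|exact: cf2].
- move=> z; rewrite normrM (gtr0_norm e0) ler_piMr ?(ltW e0)// ler_norml.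
  by move: (f1b z) (f2b z) => /andP[h1 h2] /andP[h3 h4]; apply/andP; split; lra.
move=> g' g'_eps g'_gu; apply: rareS rN => _ [s [s' [SAs SBs' -> ys']]].
exists (g' s); first by rewrite /= in_itv/= -ler_norml.
exists s => //; apply: contrapT => nNs.
pose t := k%:R * tau + g' s - g' s'.
have ts' : phi t s = s'.
  by rewrite /t addrAC -addrA addrC actD -actD addrC -[RHS](actK phi (g' s'))
    -ys'
    iter_act -!actD; congr (phi _ s); lra.
have us' : u s' = 0 by case: SBs' => _ Bs';
  rewrite /u f1G ?f2G ?subrr ?mulr0//; right.
have tk : `|t - k%:R * tau| <= eps + eps.
  have -> : t - k%:R * tau = g' s - g' s' by rewrite /t; lra.
  by apply: le_trans (ler_normB _ _) _; exact: lerD.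
have := g'_gu s; have := g'_gu s'; rewrite us' addr0 !ler_norml.
move=> /andP[a1 a2] /andP[b1 b2].
have [Es|nEs] := pselect (E s).
  have P1s : P1 s by split.
  have us : u s = e by rewrite /u f1F// f2G ?subr0 ?mulr1//; left.
  have Qs : Q s.
    split=> //; exists t; rewrite ts'; split => //=.
    by rewrite /t; move: b1 b2; rewrite us => b1 b2; lra.
  exact: EQ Es Qs.
have P2s : P2 s.
  by split => //; apply: subset_closure; split; [case: SAs|case].
have us : u s = - e by rewrite /u f2F// f1G ?sub0r ?mulrN1//; left.
apply/nEs/PE; split=> //; exists t; rewrite ts'; split => //=.
by rewrite /t; move: b1 b2; rewrite us => b1 b2; lra.
Qed.


Lemma exists_generic_function (I : countType) (k : I -> nat) (A B : I -> set X)
    (d : I -> R) (g0 : X -> R) (r0 : R) :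
  (forall i, closed (A i)) -> (forall i, closed (B i)) ->
  (forall i s, A i s -> ~ B i s) -> (forall i, 0 < d i) ->
  continuous g0 -> 0 < r0 -> (forall s, `|g0 s| + r0 <= eps) ->
  exists g : X -> R, [/\ continuous g, forall s, `|g s - g0 s| <= r0 &
    forall i, rare (d i) (phi tau) (return_graph (k i) (A i) (B i) g)].
Proof.
move=> cA cB AB d0 cg0 r00 g0eps.
(* Perturbation [n] has size at most r n / 2 and its conclusion tolerates an error of an eighth of
   that bound, which is [r n.+1]; all later perturbations together stay within this error. *)
pose r n := r0 / (16 ^ n)%:R : R.
have pow_gt0 n : 0 < (16 ^ n)%:R :> R by rewrite ltr0n expn_gt0.
have r_gt0 n : 0 < r n by rewrite divr_gt0.
have rS n : r n.+1 = r n / 2 / 8%:R.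
  by rewrite /r expnS natrM invfM -!mulrA; congr (r0 * _); lra.
(* Choosing a perturbation for every step and every function, with continuity as a premise, makes
   [G] a plain recursion. A step that encodes no index adds 0. *)
have /choice[U UP] (p : nat * (X -> R)) : exists u : X -> R, continuous p.2 ->
    [/\ continuous u, forall s, `|u s| <= r p.1 / 2 &
    forall i, unpickle p.1 = Some i -> forall g' : X -> R,
      (forall s, `|g' s| <= eps) ->
      (forall s, `|g' s - (p.2 s + u s)| <= r p.1.+1) ->
      rare (d i) (phi tau) (return_graph (k i) (A i) (B i) g')].
  case: p => n g /=; have [cg|ncg] := pselect (continuous g);
    last by exists (fun=> 0).
  have e0 : 0 < r n / 2 by rewrite divr_gt0.
  case En : (unpickle n) => [i|]; last first.
    exists (fun=> 0) => _; split => // [s|s]; first exact: cvg_cst.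
    by rewrite normr0 ltW.
  have [u [cu ue uP]] :=
    return_graph_perturbation (k i) (cA i) (cB i) (AB i) cg e0 (d0 i).
  by exists u => _; split => // _ [<-] g' g'eps; rewrite rS => /(uP _ g'eps).
pose G := fix G n := if n is m.+1 then fun s => G m s + U (m, G m) s else g0.
have cG n : continuous (G n).
  elim: n => [//|n IH] x; have [cU _ _] := UP (n, G n) IH.
  by apply: cvgD; [exact: IH|exact: cU].
have Gdist n m s : (n <= m)%N -> `|G m s - G n s| <= r n - r m.
  elim: m => [|m IH]; first by rewrite leqn0 => /eqP ->; rewrite !subrr normr0.
  rewrite leq_eqVlt => /orP[/eqP ->|]; first by rewrite !subrr normr0.
  rewrite ltnS => /IH; have [_ /(_ s) + _] := UP (m, G m) (cG m).
  have := rS m; have := r_gt0 m; rewrite /= !ler_norml.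
  set a := G m s; set b := U _ _; set c := G n s; set rm := r m; set rn := r n.
  move=> h1 h2 /andP[h3 h4] /andP[h5 h6]; apply/andP; split; lra.
have Gbound n m s : G m s - r m <= G n s + r n.
  have := r_gt0 n; have := r_gt0 m; case/orP: (leq_total n m) => /(Gdist _ _ s);
    rewrite ler_norml => /andP[]; set a := G n s; set b := G m s; lra.
(* G n s - r n is nondecreasing in n and G n s + r n nonincreasing, so that
   the sup of V is the uniform limit of G. *)
pose V s : set R := range (fun n => G n s - r n).
pose g s := sup (V s).
have supV s : has_sup (V s).
  split; first by exists (G 0%N s - r 0%N), 0%N.
  by exists (G 0%N s + r 0%N) => _ [m _ <-].
have gG n s : `|g s - G n s| <= r n.
  rewrite ler_distl; apply/andP; split.
    by apply: sup_upper_bound => //; exists n.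
  by apply: ge_sup => [|_ [m _ <-]]; [case: (supV s)|exact: Gbound].
have cg : continuous g.
  move=> x; apply/cvgrPdist_le => e e0.
  have [n rn] : exists n, r n <= e / 3.
    exists (Num.truncn (r0 / (e / 3))); rewrite ler_pdivrMr// mulrC.
    rewrite -ler_pdivrMr; last by rewrite divr_gt0.
    apply: le_trans (ltW (truncnS_gt _)) _.
    by rewrite ler_nat; exact: ltn_expl.
  have e30 : 0 < e / 3 by rewrite divr_gt0.
  have /cvgrPdist_le/(_ _ e30) := cG n x.
  apply: filterS => y; have := gG n x; have := gG n y; rewrite !ler_norml;
    move: rn.
  set a := g x; set b := g y; set c := G n x; set c' := G n y; set rn := r n.
  by move=> h /andP[h1 h2] /andP[h3 h4] /andP[h5 h6]; apply/andP; split; lra.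
have gg0 s : `|g s - g0 s| <= r0 by have := gG 0%N s; rewrite /r expn0 divr1.
exists g; split => // i; have [_ _] := UP (pickle i, G (pickle i)) (cG _).
move=> /(_ i (pickleK i)); apply => s /=; last exact: (gG (pickle i).+1 s).
apply: le_trans (g0eps s); rewrite -[g s](subrK (g0 s)).
by apply: le_trans (ler_normD _ _) _; rewrite [leRHS]addrC lerD.
Qed.

End Perturbation.

(** * Graphs of zero orbit capacity *)

Section GenericGraph.
Context {R : realType} {X : metricType R}.
Hypothesis cptX : compact [set: X].

Lemma exists_finite_net (e : R) : 0 < e ->
  exists s : seq X, forall x, exists2 c, c \in s & mdist c x < e.
Proof.
move=> e0; have [//|s [_ sP]] := compact_finite_cover
  (f := fun x => [set y : X | mdist x y < e]) cptX.
  by move=> x _; have := nbhsx_ballx x e e0; rewrite ballEmdist.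
by exists s => x; exact: sP.
Qed.

Variable phi : flow R X.

Lemma closed_act_eq (a : X * X -> R) : continuous a ->
  closed [set p : X * X | phi (a p) p.1 = p.2].
Proof.
move=> ca; rewrite -[X in closed X]setCK; apply: open_closedC.
rewrite openE => -[x y] /= xy; rewrite /interior/=.
pose e := mdist (phi (a (x, y)) x) y.
have e20 : 0 < e / 2 by rewrite divr_gt0// mdist_gt0; exact/eqP.
move: xy => _.
have /act_near[[A B] /= [aA xB] AB] := nbhsx_ballx (phi (a (x, y)) x) _ e20.
have /ca[[C D] /= [xC yD] CD] := aA.
exists (B `&` C, D `&` ball y (e / 2)) => /=.
  by split; apply: filterI => //; exact: nbhsx_ballx.
move=> [x' y'] /= [[Bx' Cx'] [Dy']]; rewrite ballEmdist /= => yy' h.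
have := AB (a (x', y'), x') (conj (CD (x', y') (conj Cx' Dy')) Bx').
rewrite /= h {h} ballEmdist /= => xy'.
have := metric_triangle (phi (a (x, y)) x) y' y; rewrite (metric_sym y' y) -/e.
by move: xy' yy'; set b := mdist _ _; set c := mdist _ _ => h1 h2 h3; lra.
Qed.

Variable tau : R.
Hypothesis tau_neq0 : tau != 0.
Hypothesis T_aperiodic : aperiodic (phi tau).
Hypothesis sfbp : SFBP phi.
Variables (eta eps : R) (S' S : set X).
Hypothesis eps_gt0 : 0 < eps.
Hypothesis eps_eta : eps + eps <= eta.
Hypothesis closed_S' : closed S'.
Hypothesis cross_S' : cross_section phi eta S'.
Hypothesis closed_S : closed S.
Hypothesis S_flow_int : S `<=` flow_int phi eta S'.

Definition graph (g : X -> R) : set X := [set phi (g s) s | s in S].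

(** For each k > 0, aperiodicity keeps the compact set of pairs of base points joined by a return
    off the diagonal. Finitely many products of disjoint cells cover it, and [g] makes the returns
    between such cells rare. *)
Lemma exists_graph_ocap_eq0 (x0 : X) (g0 : X -> R) (r0 : R) :
  continuous g0 -> 0 < r0 -> (forall s, `|g0 s| + r0 <= eps) ->
  exists g : X -> R, [/\ continuous g, forall s, `|g s - g0 s| <= r0 &
    ocap R (phi tau) (graph g) = 0].
Proof.
move=> cg0 r00 g0eps.
pose rad m : R := m.+1%:R^-1.
have rad_gt0 m : 0 < rad m by rewrite invr_gt0 ltr0n.
have /choice[net netP] m := exists_finite_net (rad_gt0 m).
pose cell m i : set X := [set y | mdist (nth x0 (net m) i) y <= rad m *+ 2].
pose disj m i j := `[< forall s, cell m i s -> ~ cell m j s >].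
(* An index holds the iterate k, the accuracy 1 / (l + 1), the scale m of the net and two net
   points. [A] is emptied when the cells meet, so that [A] and [B] are always disjoint. *)
pose I : countType := (nat * nat * (nat * nat * nat))%type.
pose A (z : I) := let: (_, _, (m, i, j)) := z in
  if disj m i j then cell m i else set0.
pose B (z : I) := let: (_, _, (m, _, j)) := z in cell m j.
have [| | | |g [cg gg0 gP]] := @exists_generic_function R X cptX phi tau
  tau_neq0
  sfbp eta eps S' S eps_gt0 eps_eta closed_S' cross_S' closed_S S_flow_int
  I (fun z => z.1.1) A B (fun z => rad z.1.2) g0 r0 _ _ _ _ cg0 r00 g0eps.
- move=> [[k l] [[m i] j]] /=; case: ifP => _; last exact: closed0.
  exact: closed_mdist_ball.
- by move=> [[k l] [[m i] j]]; exact: closed_mdist_ball.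
- by move=> [[k l] [[m i] j]] s /=; case: ifPn => // /asboolP; apply.
- by move=> z; exact: rad_gt0.
exists g; split => //; apply: sparse_returns_ocap_eq0 => k k0.
pose K : set (X * X) := (S `*` S) `&`
  [set p | phi (k%:R * tau + g p.1 - g p.2) p.1 = p.2].
have cK : compact K.
  apply: compact_closedI; first by apply: compact_setX; exact: compactX.
  apply: (@closed_act_eq (fun p => k%:R * tau + g p.1 - g p.2)) => p.
  apply: cvgB; last by apply: continuous_comp; [exact: cvg_snd|exact: cg].
  apply: cvgD; first exact: cvg_cst.
  by apply: continuous_comp; [exact: cvg_fst|exact: cg].
(* The cells do not depend on the accuracy [l]; 0 stands in for it until it is chosen at the end. *)
have /choice[idx idxP] (p : X * X) : exists z : nat * nat * nat, K p ->
    nbhs p (A (k, 0%N, z) `*` B (k, 0%N, z)).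
  have [Kp|nKp] := pselect (K p); last by exists (0, 0, 0)%N.
  case: p Kp => s s' [[/= Ss Ss'] sts'].
  have ss' : s != s'.
    apply/eqP => ss'; apply: T_aperiodic; exists s, k; split => //.
    by move: sts'; rewrite /= -ss' addrK -iter_act.
  (* Were the two cells to meet, going from s to s' through both net points would cost less than 1 +
     2 + 2 + 1 times [rad m]. *)
  pose e := mdist s s' / 6%:R.
  have e0 : 0 < e by rewrite divr_gt0// mdist_gt0.
  have [m me] : exists m, rad m < e.
    exists (Num.truncn e^-1); rewrite /rad -[ltRHS]invrK.
    by rewrite ltf_pV2 ?posrE ?invr_gt0 ?ltr0n// truncnS_gt.
  have [c cm cs] := netP m s; have [c' c'm c's'] := netP m s'.
  exists (m, index c (net m), index c' (net m)) => _.
  have disj_cc' : disj m (index c (net m)) (index c' (net m)).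
    apply/asboolP => z; rewrite /cell/= !nth_index// => h1 h2.
    have := metric_triangle s c s'; have := metric_triangle c z s'.
    have := metric_triangle z c' s'; rewrite (metric_sym s c) (metric_sym z c').
    have : mdist s s' = e * 6%:R by rewrite divfK.
    move: h1 h2 cs c's' me.
    set a1 := mdist c z; set a2 := mdist c' z; set a3 := mdist c s.
    set a4 := mdist c' s'; set a5 := mdist z s'; set a6 := mdist c s'.
    by set a7 := mdist s s' => h1 h2 h3 h4 h5 h6 h7 h8 h9; lra.
  rewrite /A /B disj_cc'.
  have near_cell y d : mdist d y < rad m ->
    nbhs y [set z | mdist d z <= rad m *+ 2].
    move=> dy; have := nbhsx_ballx y _ (rad_gt0 m); apply: filterS => z.
    rewrite ballEmdist /= => yz; apply: (le_trans (metric_triangle _ y _)).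
    by move: dy yz; set a := mdist _ _; set b := mdist _ _; lra.
  exists (cell m (index c (net m)), cell m (index c' (net m))) => //=.
  by split; rewrite /cell nth_index//; exact: near_cell.
have [ps [_ psK]] := compact_finite_cover cK idxP.
apply: (@ocap_eq0S _ _ _ _ (\bigcup_(p in [set` ps])
    return_graph phi tau S k (A (k, 0%N, idx p)) (B (k, 0%N, idx p)) g)).
  move=> _ [[s Ss <-]] [s' Ss' ts']; have Kss' : K (s, s').
    split=> //=; rewrite addrAC -addrA addrC actD -[RHS](actK phi (g s')).
    by rewrite ts' iter_act -actD -actD -actD; congr (phi _ s); lra.
  have [p pps [Ap Bp]] := psK _ Kss'.
  by exists p => //; exists s, s'.
apply: ocap_bigcup_seq_eq0 => p _; apply/eqP; rewrite eq_le ocap_ge0 andbT.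
apply/ler_addgt0Pl => e e0; rewrite addr0.
have [l le] : exists l, rad l <= e.
  exists (Num.truncn e^-1); rewrite /rad -[leRHS]invrK.
  by rewrite lef_pV2 ?posrE ?invr_gt0 ?ltr0n// ltW// truncnS_gt.
apply: le_trans le; apply: rare_ocap; first exact: ltW.
exact: (gP (k, l, idx p)).
Qed.

End GenericGraph.

(** * Flow boxes *)

Section FlowBox.
Context {R : realType} {X : metricType R}.
Hypothesis cptX : compact [set: X].
Variable phi : flow R X.
Variables (eta eps : R) (S : set X) (g1 g2 : X -> R).
Hypothesis closed_S : closed S.
Hypothesis cross_S : cross_section phi eta S.
Hypotheses (cg1 : continuous g1) (cg2 : continuous g2).
Hypotheses (g1_eps : forall s, - eps <= g1 s) (g2_eps : forall s, g2 s <= eps).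

Definition flow_box : set X :=
  (fun p : R * X => phi p.1 p.2) @` [set p | S p.2 /\ g1 p.2 <= p.1 <= g2 p.2].

Lemma closed_flow_box : closed flow_box.
Proof.
rewrite /flow_box; apply: closed_act_image.
have -> : [set p : R * X | S p.2 /\ g1 p.2 <= p.1 <= g2 p.2] =
    (`[- eps, eps] `*` S) `&`
    ([set p | 0 <= p.1 - g1 p.2] `&` [set p | 0 <= g2 p.2 - p.1]).
  apply/seteqP; split=> [[t s] /= [Ss /andP[h1 h2]]|[t s] /= [[_ Ss] [h1 h2]]].
    rewrite !subr_ge0 in_itv/= (le_trans (g1_eps s))// (le_trans h2)//.
  by move: h1 h2; rewrite !subr_ge0 => -> ->.
apply: compact_closedI.
  by apply: compact_setX; [exact: segment_compact|exact: compactX].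
apply: closedI.
  apply: (@preimage_closed _ _ (fun p : R * X => p.1 - g1 p.2) [set z | 0 <=
    z]).
    move=> p _; apply: cvgB; first exact: cvg_fst.
    by apply: continuous_comp; [exact: cvg_snd|exact: cg1].
  exact: closed_ge.
apply: (@preimage_closed _ _ (fun p : R * X => g2 p.2 - p.1) [set z | 0 <= z]).
  move=> p _; apply: cvgB; last exact: cvg_fst.
  by apply: continuous_comp; [exact: cvg_snd|exact: cg2].
exact: closed_ge.
Qed.

Lemma flow_box_interior s t : flow_int phi eta S s -> g1 s < t < g2 s ->
  nbhs (phi t s) flow_box.
Proof.
move=> iSs /andP[h1 h2].
(* Half of the margin is left for the variation of [g1] and [g2] near [s], half for the shift in
   time. *)
pose e := Num.min (t - g1 s) (g2 s - t) / 2.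
have e0 : 0 < e by rewrite divr_gt0// lt_min !subr_gt0 h1.
have [e1 e2] : e + e <= t - g1 s /\ e + e <= g2 s - t.
  by rewrite /e -splitr !ge_min !lexx orbT.
have near_g : nbhs s [set z | g1 z <= g1 s + e /\ g2 s - e <= g2 z].
  have /cvgrPdist_le/(_ _ e0) n1 := @cg1 s.
  have /cvgrPdist_le/(_ _ e0) n2 := @cg2 s.
  apply: filterS (filterI n1 n2) => z /= []; rewrite !ler_norml.
  set a := g1 s; set a' := g1 z; set b := g2 s; set b' := g2 z.
  by move=> /andP[? ?] /andP[? ?]; split; lra.
have near_s := flow_int_nbhs cptX closed_S cross_S iSs e0 near_g.
pose W := flow_seg phi (- e) e
  (S `&` [set z | g1 z <= g1 s + e /\ g2 s - e <= g2 z]).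
have near_ts : nbhs (phi t s) (phi (- t) @^-1` W).
  by apply: act_continuous_space; rewrite actK.
apply: filterS near_ts => y [t' t'e [s' [Ss' [gs1 gs2]] tss']].
exists (t + t', s'); last by rewrite /= actD tss' actNK.
split=> //=; move: t'e; rewrite /= in_itv/= => /andP[t1 t2].
by apply/andP; move: e1 e2 gs1 gs2 t1 t2; clear tss'; split; lra.
Qed.

Lemma boundary_flow_box : boundary flow_box `<=`
  flow_seg phi (- eps) eps (flow_bd phi eta S) `|` (graph phi S g1 `|` graph
    phi S g2).
Proof.
move=> y []; rewrite -(iffLR (closure_id _) closed_flow_box).
move=> [[t s] /= [Ss /andP[h1 h2]] <-] nint.
have [iSs|nSs] := pselect (flow_int phi eta S s); last first.
  left; exists t; first by rewrite /= in_itv/= (le_trans (g1_eps s))//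
    (le_trans h2).
  by exists s => //; split => //; exact: subset_closure.
right; move: h1 h2; rewrite !le_eqVlt => /orP[/eqP g1t _|h1].
  by left; exists s => //; rewrite g1t.
move=> /orP[/eqP g2t|h2]; first by right; exists s => //; rewrite -g2t.
by case: nint; apply: flow_box_interior => //; rewrite h1.
Qed.

End FlowBox.

(** * Small boundaries from flow boxes, and the equivalence *)

Lemma SFBP_aperiodic_SBP (R : realType) (X : metricType R) (phi : flow R X)
    (tau : R) : compact [set: X] -> SFBP phi -> aperiodic (phi tau) ->
  SBP R (phi tau).
Proof.
move=> cptX sfbp aper x U xU.
have tau_neq0 : tau != 0.
  by apply/eqP => tau0; apply: aper; exists x, 1%N; rewrite /= tau0 act0.
have moves : exists t, phi t x <> x.
  apply: contrapT => /forallNP h; apply: sfbp.1.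
  by exists x => t; apply: contrapT.
have /act_near[[A B] /= [A0 xB] ABU] : nbhs (phi 0 x) U by rewrite act0.
have [eta [S' [cS' csS' xS' S'B]]] := exists_cross_section moves xB.
have eta0 : 0 < eta by case: csS'.
(* The section is first cut down to a ball inside its own thickening, so that the set given by SFBP
   lies in the flow interior of [S'], as the perturbation requires. *)
have [r r0 rS'] := nbhs_mdist_ball (nbhs_interior xS'.1).
pose S1 := S' `&` [set y | mdist x y <= r].
have cS1 : closed S1 by apply: closedI => //; exact: closed_mdist_ball.
have S1S' : S1 `<=` S' by exact: subIsetl.
have csS1 : cross_section phi eta S1 by exact: cross_sectionS csS'.
have xS1 : flow_int phi eta S1 x.
  by apply: (flow_int_setI cptX cS' csS' xS'); exact: mdist_ball_nbhs.
have [S [cS SS1 xS sS]] := sfbp.2 x eta S1 cS1 csS1 xS1.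
have S_int : S `<=` flow_int phi eta S' by move=> y /SS1[S'y /rS' iy]; split.
have csS : cross_section phi eta S by exact: cross_sectionS csS1.
have [a /= a0 aA] := iffLR (nbhs_ballP _ _) A0.
pose eps := Num.min a eta / 2.
have eps0 : 0 < eps by rewrite divr_gt0// lt_min a0.
have eps_a : eps + eps <= a by rewrite /eps -splitr ge_min lexx.
have eps_eta : eps + eps <= eta by rewrite /eps -splitr ge_min lexx orbT.
have eps40 : 0 < eps / 4 by rewrite divr_gt0.
(* Functions within eps / 4 of - eps / 2 and of eps / 2 stay in [- eps, eps] and leave the times
   [- eps / 4, eps / 4] between them, so the box is a neighbourhood of [x]. *)
have generic (c : R) : `|c| = eps / 2 -> exists g : X -> R,
    [/\ continuous g, forall s, `|g s - c| <= eps / 4 &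
    ocap R (phi tau) (graph phi S g) = 0].
  move=> ce; apply: (exists_graph_ocap_eq0 cptX tau_neq0 aper sfbp eps0
    eps_eta cS' csS' cS S_int x (g0 := fun=> c)) => //.
    by move=> z; exact: cvg_cst.
  by move=> z; rewrite ce; lra.
have e2 : 0 <= eps / 2 by rewrite divr_ge0// ltW.
have [g1 [cg1 g1b g10]] : exists g : X -> R, [/\ continuous g,
    forall s, `|g s - (- (eps / 2))| <= eps / 4 &
    ocap R (phi tau) (graph phi S g) = 0].
  by apply: generic; rewrite normrN ger0_norm.
have [g2 [cg2 g2b g20]] := generic (eps / 2) (ger0_norm e2).
have g1_eps s : - eps <= g1 s <= - (eps / 4).
  by have := g1b s; rewrite ler_norml => /andP[? ?]; apply/andP; split; lra.
have g2_eps s : eps / 4 <= g2 s <= eps.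
  by have := g2b s; rewrite ler_norml => /andP[? ?]; apply/andP; split; lra.
have g1_ge s : - eps <= g1 s by case/andP: (g1_eps s).
have g2_le s : g2 s <= eps by case/andP: (g2_eps s).
exists (flow_box phi S g1 g2); split.
- apply: filterS (flow_int_nbhs cptX cS csS xS eps40 filterT) => _ [t te [s [Ss
    _] <-]].
  exists (t, s) => //; split => //=; move: te;
    rewrite /= in_itv/= => /andP[t1 t2].
  have /andP[_ h1] := g1_eps s; have /andP[h2 _] := g2_eps s.
  by rewrite (le_trans h1 t1) (le_trans t2 h2).
- move=> _ [[t s] /= [Ss /andP[h1 h2]] <-].
  apply: (ABU (t, s)); split => /=; last exact: S'B (S1S' _ (SS1 _ Ss)).
  apply: aA; rewrite /ball/= sub0r normrN; apply: (@le_lt_trans _ _ eps);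
    last by lra.
  by rewrite ler_norml (le_trans (g1_ge s))// (le_trans h2).
- apply: ocap_eq0S (boundary_flow_box cptX cS csS cg1 cg2 g1_ge g2_le) _.
  apply: ocapU_eq0; last exact: ocapU_eq0.
  apply: (null_flow_seg_ocap cptX tau_neq0 _ (@closed_flow_bd _ _ phi eta _ cS)
    sS).
  by lra.
Qed.

Theorem theorem1 (R : realType) (X : metricType R) (phi : flow R X)
    (cptX : compact [set: X]) (sfbp : SFBP phi) (tau : R) :
  aperiodic (phi tau) <-> SBP R (phi tau).
Proof.
split; first exact: SFBP_aperiodic_SBP.
by apply: SBP_aperiodic; case: sfbp.
Qed.
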